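(* Let $T\ge 1$ be an integer, and let $B^{(T)}(z)=z+a_0z^{1+T}+b_0z^{1+2T}$, where $$a_0=\frac{2}{2+3T}\left(-T+(2+2T)\cos\left(\frac{\pi T}{2+3T}\right)\right),\qquad b_0=\frac{1}{2+3T}\left(2+T-2T\cos\left(\frac{\pi T}{2+3T}\right)\right).$$ Then $$\min_{F\in\mathcal{S}^T}\ \min_{z\in\mathbb{C},\,|z|=1}|F(z)|=\left|B^{(T)}\left(e^{i\pi/T}\right)\right|=4\cos^2\left(\frac{\pi(1+T)}{2+3T}\right).$$
   Context: Let $\mathbb{D}=\{z\in\mathbb{C}:|z|<1\}$. A function is univalent in $\mathbb{D}$ if it is holomorphic and injective there. For an integer $T\ge1$, $\mathcal{S}^T$ denotes the set of all polynomials $F(z)=z+az^{1+T}+bz^{1+2T}$ with real coefficients $a,b$ that are univalent in $\mathbb{D}$. *)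

(* Defs.v *)
From Stdlib Require Import Reals.
From Coquelicot Require Import Coquelicot.

Open Scope R_scope.

(* Coquelicot has no complex exponential. *)
Definition Cexp (z : C) : C := (exp (Re z) * (cos (Im z), sin (Im z)))%C.

Definition unit_disk (z : C) : Prop := Cmod z < 1.

(* The unit disk is open, so being holomorphic there is complex
   differentiability at each of its points. *)
Definition holomorphic_on (D : C -> Prop) (f : C -> C) : Prop :=
  forall z : C, D z -> ex_derive f z.

Definition injective_on (D : C -> Prop) (f : C -> C) : Prop :=
  forall z w : C, D z -> D w -> f z = f w -> z = w.

Definition univalent (f : C -> C) : Prop :=
  holomorphic_on unit_disk f /\ injective_on unit_disk f.

Definition trinomial (T : nat) (a b : R) (z : C) : C :=
  (z + a * Cpow z (1 + T) + b * Cpow z (1 + 2 * T))%C.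

Definition class_S (T : nat) (F : C -> C) : Prop :=
  (exists a b : R, forall z : C, F z = trinomial T a b z) /\ univalent F.

Definition is_minimum (E : R -> Prop) (m : R) : Prop :=
  E m /\ forall x : R, E x -> m <= x.

(* [m] is the minimum of |F(z)| over the circle |z| = 1. *)
Definition is_circle_min (F : C -> C) (m : R) : Prop :=
  is_minimum (fun r => exists z : C, Cmod z = 1 /\ r = Cmod (F z)) m.

Definition a0 (T : nat) : R :=
  2 / (2 + 3 * INR T) *
  (- INR T + (2 + 2 * INR T) * cos (PI * INR T / (2 + 3 * INR T))).

Definition b0 (T : nat) : R :=
  1 / (2 + 3 * INR T) *
  (2 + INR T - 2 * INR T * cos (PI * INR T / (2 + 3 * INR T))).

Definition B (T : nat) : C -> C := trinomial T (a0 T) (b0 T).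

(* Main.v *)
Require Import Defs.
From Stdlib Require Import Reals Lra Lia.
From Coquelicot Require Import Coquelicot.

Open Scope R_scope.

(** Write F(z) = z + a z^(1+T) + b z^(1+2T) and N = 2 + 3T. On |z| = 1, with
    w = z^T, |F(z)| = |1 + a w + b w^2| depends only on x = Re w, and its square
    is a quadratic polynomial in x ([circle_form], [Cmod_trinomial_cis]). The
    question is thus which pairs (a, b) give an injective F.

    Comparing F at z e^(it) and z e^(-it) gives
      F(z e^(it)) - F(z e^(-it))
        = 2 i z (sin t + a sin((1+T)t) w + b sin((1+2T)t) w^2),
    so injectivity forbids zeros of this real quadratic in 0 < |w| < 1. This
    forces b <= 1/(1+2T) and, for every t in (0, pi),
      |a sin((1+T)t)| <= sin t + b sin((1+2T)t)
    ([dieudonne_condition], [last_coefficient_bound]). Conversely, these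
    inequalities together with |b| (1+2T) <= 1 imply injectivity
    ([dieudonne_injective]): for a collision F(z) = F(yz) with |y| <= 1 the number
    1/z^T is a root of v^2 + a A(y) v + b C(y), where A and C are geometric
    polynomials in y. The inequalities say that both roots lie in the closed unit
    disk when |y| = 1. The power sums of the roots are polynomials in y bounded
    by 2 on the circle, hence bounded at y uniformly in the exponent by a
    discrete Cauchy formula, so the roots stay in the closed unit disk for
    |y| < 1 too.

    Let c = cos(pi T / N) and m = 2 - 2c, which is the claimed minimum
    ([koebe_radius_eq]). The inequality at the angle pi/N reads |a| <= b + 2c - 1,
    that is, 1 + b - |a| >= m: this bounds |F| from below at the end points
    x = 1 and x = -1. If b > 0 the minimum over x may be attained in the interior,
    where |F|^2 is (1-b)^2 (1 - a^2/(4b)). There the inequality at pi/(2(1+T)),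
    namely a <= (1+b) sin(pi/(2(1+T))), suffices for T >= 2, without any
    slack for T = 2 ([interior_bound_T2], [interior_bound_T3]);
    for T = 1 the envelope a^2 <= 4b(1-b) of all the inequalities is used
    ([interior_bound_T1]).

    The coefficients of B are those for which the inequality at pi/N is an
    equality and t = pi/N is a critical point of
      (sin t + b sin((1+2T)t)) / sin((1+T)t).
    The sign of the derivative shows that this is a global minimum on
    (0, pi/(1+T)) ([extremal_condition_first_arch]); from there to pi/2,
    sin t alone is at least a + b if T >= 2, while for T = 1 only pi/2 is left.
    Hence B is injective, and |B(e^(i pi/T))| = 1 - a + b = m. *)

(** * Points of the unit circle *)

Definition cis (t : R) : C := (cos t, sin t).

Lemma cis_plus (s t : R) : cis (s + t) = (cis s * cis t)%C.
Proof.
  unfold cis, Cmult; simpl; rewrite cos_plus, sin_plus.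
  f_equal; ring.
Qed.

Lemma cis_0 : cis 0 = 1%C.
Proof. unfold cis; rewrite cos_0, sin_0; reflexivity. Qed.

Lemma cis_pow (t : R) (n : nat) : (cis t ^ n)%C = cis (INR n * t).
Proof.
  induction n as [|n IH].
  - simpl; rewrite Rmult_0_l, cis_0; reflexivity.
  - rewrite Cpow_S, IH, <- cis_plus, S_INR; f_equal; ring.
Qed.

Lemma Cmod_cis (t : R) : Cmod (cis t) = 1.
Proof.
  unfold Cmod, cis; simpl.
  replace (_ + _) with 1; [apply sqrt_1|].
  generalize (sin2_cos2 t); unfold Rsqr; lra.
Qed.

Lemma cis_minus_conj (t : R) : (cis t - cis (- t))%C = (2 * Ci * sin t)%C.
Proof.
  unfold cis; rewrite cos_neg, sin_neg.
  unfold Cminus, Cplus, Copp, Cmult, Ci, RtoC; simpl; f_equal; ring.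
Qed.

Lemma Cexp_imaginary (t : R) : Cexp (Ci * t)%C = cis t.
Proof.
  unfold Cexp, cis, Ci, RtoC, Cmult, Re, Im; simpl.
  replace (0 * t - 1 * 0) with 0 by ring.
  replace (0 * 0 + 1 * t) with t by ring.
  rewrite exp_0; f_equal; ring.
Qed.

(** Angles are taken in [0, 2 pi) so that halving them gives the interval
    [0, pi) on which the coefficient conditions are stated. *)
Lemma unit_circle_cis (z : C) :
  Cmod z = 1 -> exists t, 0 <= t < 2 * PI /\ z = cis t.
Proof.
  intros Hz.
  assert (H : fst z ^ 2 + snd z ^ 2 = 1).
  { generalize (Cmod2_alt z); rewrite Hz; unfold Re, Im; lra. }
  destruct z as [x y]; simpl in H.
  assert (Hx : -1 <= x <= 1) by nra.
  pose proof PI_RGT_0.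
  pose proof (acos_bound x).
  assert (Hs : sqrt (1 - x²) = Rabs y).
  { rewrite <- sqrt_Rsqr_abs; f_equal; unfold Rsqr; lra. }
  destruct (Rle_lt_dec 0 y) as [Hy|Hy].
  - exists (acos x); split; [lra|].
    unfold cis; rewrite cos_acos, sin_acos, Hs by easy.
    rewrite Rabs_pos_eq; auto.
  - exists (2 * PI - acos x); split.
    + split; [lra|].
      destruct (Req_dec (acos x) 0) as [E|E]; [|lra].
      exfalso. assert (x = 1) by (rewrite <- (cos_acos x), E, cos_0; auto).
      subst; nra.
    + unfold cis.
      replace (2 * PI - acos x) with (- acos x + 2 * INR 1 * PI) by (simpl; ring).
      rewrite cos_period, sin_period, cos_neg, sin_neg, cos_acos, sin_acos, Hs by easy.
      rewrite Rabs_left; auto; f_equal; ring.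
Qed.

Lemma nth_root_in_disk (T : nat) (w : C) :
  (1 <= T)%nat -> w <> 0%C -> Cmod w < 1 ->
  exists z, (z ^ T)%C = w /\ z <> 0%C /\ Cmod z < 1.
Proof.
  intros HT Hw Hw1.
  assert (Hr : 0 < Cmod w) by (apply Cmod_gt_0; auto).
  assert (HT' : 0 < INR T) by (apply lt_0_INR; lia).
  assert (Hu : Cmod (w / Cmod w)%C = 1).
  { rewrite Cmod_div, Cmod_R, Rabs_pos_eq by (try lra; intros E; injection E; lra).
    field; lra. }
  destruct (unit_circle_cis _ Hu) as (t & _ & Ht).
  set (r := Rpower (Cmod w) (/ INR T)).
  assert (Hr0 : 0 < r) by apply exp_pos.
  assert (Hrn : (r ^ T)%R = Cmod w).
  { rewrite <- Rpower_pow by auto. unfold r.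
    rewrite Rpower_mult, Rinv_l, Rpower_1; lra. }
  assert (Hz : Cmod (r * cis (t / INR T))%C = r).
  { rewrite Cmod_mult, Cmod_cis, Cmod_R, Rabs_pos_eq; lra. }
  exists (r * cis (t / INR T))%C; split; [|split].
  - rewrite Cpow_mult_l, cis_pow, <- RtoC_pow, Hrn.
    replace (INR T * (t / INR T)) with t by (field; lra).
    rewrite <- Ht. field. intros E; injection E; lra.
  - apply Cmod_gt_0; lra.
  - rewrite Hz. destruct (Rlt_le_dec r 1) as [|H1]; auto.
    pose proof (pow_R1_Rle r T H1). lra.
Qed.

(** * Polynomial bounds for sine, cosine and pi *)

Lemma sin_cubic_lower (x : R) : 0 <= x <= PI -> x - x ^ 3 / 6 <= sin x.
Proof.
  intros Hx. destruct (sin_bound x 0) as [H _]; try lra.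
  unfold sin_approx, sum_f_R0, sin_term in H; simpl in H. lra.
Qed.

Lemma cos_quadratic_lower (x : R) : 0 <= x <= PI / 2 -> 1 - x ^ 2 / 2 <= cos x.
Proof.
  intros Hx. destruct (cos_bound x 0) as [H _]; try lra.
  unfold cos_approx, sum_f_R0, cos_term in H; simpl in H. lra.
Qed.

Lemma sin_quintic_upper (x : R) : 0 <= x <= PI -> sin x <= x - x ^ 3 / 6 + x ^ 5 / 120.
Proof.
  intros Hx. destruct (sin_bound x 0) as [_ H]; try lra.
  unfold sin_approx, sum_f_R0, sin_term in H; simpl in H. lra.
Qed.

Lemma sin_septic_lower (x : R) :
  0 <= x <= PI -> x - x ^ 3 / 6 + x ^ 5 / 120 - x ^ 7 / 5040 <= sin x.
Proof.
  intros Hx. destruct (sin_bound x 1) as [H _]; try lra.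
  unfold sin_approx, sum_f_R0, sin_term in H.
  cbn [Nat.mul Nat.add] in H.
  rewrite !fact_simpl, !mult_INR in H. simpl in H. lra.
Qed.

(** Both bounds compare sin(pi/6) = 1/2 with a Taylor polynomial. *)
Lemma PI_bounds : 3.1415 < PI < 3.1416.
Proof.
  pose proof PI_4. pose proof PI2_3_2. pose proof sin_PI6.
  split.
  - assert (3.1415 / 6 < PI / 6); [|lra].
    apply sin_increasing_0; try lra. rewrite sin_PI6.
    eapply Rle_lt_trans; [apply sin_quintic_upper|]; lra.
  - assert (PI / 6 < 3.1416 / 6); [|lra].
    apply sin_increasing_0; try lra. rewrite sin_PI6.
    eapply Rlt_le_trans; [|apply sin_septic_lower]; lra.
Qed.

Lemma mean_value (f f' : R -> R) (x y : R) :
  x < y -> (forall z, x <= z <= y -> is_derive f z (f' z)) ->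
  exists z, x < z < y /\ f y - f x = f' z * (y - x).
Proof.
  intros Hxy Hf. destruct (MVT_cor2 f f' x y Hxy) as (z & E & Hz).
  - intros z Hz. apply is_derive_Reals. auto.
  - exists z; auto.
Qed.

(** * What injectivity forces on the coefficients *)

(** A zero w = z^T of this quadratic makes z e^(it) and z e^(-it) collide, since
    e^(ix) - e^(-ix) = 2 i sin x turns the difference of the two values into
    2 i z times the quadratic. *)
Lemma injective_quadratic_nonzero (T : nat) (a b t : R) (w : C) :
  (1 <= T)%nat -> injective_on unit_disk (trinomial T a b) -> sin t <> 0 ->
  w <> 0%C -> Cmod w < 1 ->
  (sin t + a * sin (INR (1 + T) * t) * w
     + b * sin (INR (1 + 2 * T) * t) * (w * w))%C <> 0%C.
Proof.
  intros HT Hinj Hs Hw Hw1 E.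
  destruct (nth_root_in_disk T w HT Hw Hw1) as (z & Hz & Hz0 & Hz1).
  assert (Heq : (z * cis t)%C = (z * cis (- t))%C).
  { apply Hinj.
    - unfold unit_disk; rewrite Cmod_mult, Cmod_cis; lra.
    - unfold unit_disk; rewrite Cmod_mult, Cmod_cis; lra.
    - assert (Hd : (trinomial T a b (z * cis t) - trinomial T a b (z * cis (- t)) =
        z * (cis t - cis (- t)) +
        a * (z * z ^ T) * (cis (INR (1 + T) * t) - cis (- (INR (1 + T) * t))) +
        b * (z * (z ^ T * z ^ T)) * (cis (INR (1 + 2 * T) * t) - cis (- (INR (1 + 2 * T) * t))))%C).
      { unfold trinomial.
        rewrite !Ropp_mult_distr_r, !Cpow_mult_l, !cis_pow.
        replace (1 + 2 * T)%nat with (1 + (T + T))%nat by lia.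
        rewrite !(Cpow_add_r z), Cpow_1_r. ring. }
      rewrite !cis_minus_conj, Hz in Hd.
      replace (_ + _)%C with (2 * Ci * z * 0)%C in Hd by (rewrite <- E; ring).
      rewrite Cmult_0_r in Hd.
      rewrite <- (Cplus_0_l (trinomial T a b (z * cis (- t)))), <- Hd. ring. }
  assert (Hc : (z * (2 * Ci * sin t) = 0)%C).
  { rewrite <- cis_minus_conj, <- (Cplus_opp_r (z * cis t)).
    rewrite Heq at 2. ring. }
  apply (f_equal Cmod) in Hc.
  rewrite !Cmod_mult, Cmod_Ci, !Cmod_R, Rabs_R0 in Hc.
  apply Cmod_gt_0 in Hz0. apply Rabs_pos_lt in Hs.
  rewrite (Rabs_pos_eq 2) in Hc by lra. nra.
Qed.

Lemma quadratic_root_unit_interval (p q r : R) :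
  0 < p -> p + q + r < 0 -> exists x, 0 < x < 1 /\ p + q * x + r * (x * x) = 0.
Proof.
  intros Hp Hs.
  destruct (IVT_cor (fun x => p + q * x + r * (x * x)) 0 1) as (x & Hx & E).
  - intros x; reg.
  - lra.
  - nra.
  - exists x; split; auto.
    split; [destruct (Req_dec x 0)|destruct (Req_dec x 1)]; subst; lra.
Qed.

(** If the inequality fails, the quadratic of [injective_quadratic_nonzero] is positive at
    0 and negative at 1 or at -1, so it has a real zero in between. *)
Theorem dieudonne_condition (T : nat) (a b t : R) :
  (1 <= T)%nat -> injective_on unit_disk (trinomial T a b) -> 0 < t < PI ->
  Rabs (a * sin (INR (1 + T) * t)) <= sin t + b * sin (INR (1 + 2 * T) * t).
Proof.
  intros HT Hinj Ht.
  pose proof (sin_gt_0 t (proj1 Ht) (proj2 Ht)) as Hs.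
  set (A := a * sin (INR (1 + T) * t)).
  set (B := b * sin (INR (1 + 2 * T) * t)).
  destruct (Rle_lt_dec (Rabs A) (sin t + B)) as [|Hlt]; auto.
  exfalso.
  assert (Hroot : exists x, x <> 0 /\ Rabs x < 1 /\ sin t + A * x + B * (x * x) = 0).
  { destruct (Rle_lt_dec 0 A) as [HA|HA].
    - rewrite Rabs_pos_eq in Hlt by auto.
      destruct (quadratic_root_unit_interval (sin t) (- A) B) as (x & Hx & E); [lra|lra|].
      exists (- x); split; [lra|split; [apply Rabs_def1; lra|lra]].
    - rewrite Rabs_left in Hlt by auto.
      destruct (quadratic_root_unit_interval (sin t) A B) as (x & Hx & E); [lra|lra|].
      exists x; split; [lra|split; [apply Rabs_def1; lra|lra]]. }
  destruct Hroot as (x & Hx0 & Hx1 & E).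
  apply (injective_quadratic_nonzero T a b t x HT Hinj).
  - lra.
  - intros F; injection F; auto.
  - rewrite Cmod_R; auto.
  - rewrite <- !RtoC_mult, <- !RtoC_plus. f_equal. exact E.
Qed.

(** The product of the two roots is p/r < 1. A conjugate pair then lies inside the
    disk, and of two real roots the one closer to 0 does. *)
Lemma quadratic_root_unit_disk (p q r : R) :
  0 < p < r -> exists w : C, w <> 0%C /\ Cmod w < 1 /\ (p + q * w + r * (w * w))%C = 0%C.
Proof.
  intros Hp.
  destruct (Rle_lt_dec (4 * p * r) (q * q)) as [Hd|Hd].
  - assert (Hreal : exists x, x * x < 1 /\ p + q * x + r * (x * x) = 0).
    { set (s := sqrt (q * q - 4 * p * r)).
      assert (Hs2 : s * s = q * q - 4 * p * r) by (apply sqrt_sqrt; lra).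
      assert (Hs0 : 0 <= s) by apply sqrt_pos.
      destruct (Rle_lt_dec 0 q) as [Hq|Hq].
      - exists ((s - q) / (2 * r)).
        split; [|field_simplify; [|lra]].
        + assert (s <= q) by nra.
          apply Rmult_lt_reg_r with (4 * r * r); [nra|].
          field_simplify; [|lra]. nra.
        + replace (s ^ 2) with (q * q - 4 * p * r) by (rewrite <- Hs2; ring). field; lra.
      - exists ((- s - q) / (2 * r)).
        split; [|field_simplify; [|lra]].
        + assert (s <= - q) by nra.
          apply Rmult_lt_reg_r with (4 * r * r); [nra|].
          field_simplify; [|lra]. nra.
        + replace (s ^ 2) with (q * q - 4 * p * r) by (rewrite <- Hs2; ring). field; lra. }
    destruct Hreal as (x & Hx1 & E).
    exists x; split; [|split].
    + intros F; injection F; intros ->; lra.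
    + rewrite Cmod_R. apply Rabs_def1; nra.
    + rewrite <- !RtoC_mult, <- !RtoC_plus. f_equal. exact E.
  - set (s := sqrt (4 * p * r - q * q)).
    assert (Hs2 : s * s = 4 * p * r - q * q) by (apply sqrt_sqrt; lra).
    assert (Hs0 : 0 < s) by (apply sqrt_lt_R0; lra).
    assert (Hsd : 0 < s / (2 * r)) by (apply Rdiv_lt_0_compat; lra).
    exists (- q / (2 * r), s / (2 * r)); split; [|split].
    + intros F; injection F; lra.
    + apply Rsqr_incrst_0; [|apply Cmod_ge_0|lra].
      rewrite !Rsqr_pow2, Cmod2_alt; simpl.
      apply Rmult_lt_reg_r with (4 * r * r); [nra|].
      field_simplify; [|lra]. nra.
    + unfold Cplus, Cmult, RtoC; simpl. f_equal.
      * field_simplify; [|lra]. replace (s ^ 2) with (4 * p * r - q * q) by (rewrite <- Hs2; ring). field; lra.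
      * field; lra.
Qed.

(** As t tends to 0, sin((1+2T)t)/sin t tends to 1+2T. If b (1+2T) > 1, then for small
    t the leading coefficient of the quadratic exceeds its constant term, which
    forces a zero in the disk. *)
Theorem last_coefficient_bound (T : nat) (a b : R) :
  (1 <= T)%nat -> injective_on unit_disk (trinomial T a b) -> b <= / INR (1 + 2 * T).
Proof.
  intros HT Hinj.
  set (n := INR (1 + 2 * T)).
  assert (Hn : 3 <= n).
  { unfold n. replace 3 with (INR 3) by (simpl; ring). apply le_INR; lia. }
  destruct (Rle_lt_dec b (/ n)) as [|Hb]; auto. exfalso.
  assert (Hb0 : 0 < b) by (apply Rlt_trans with (/ n); auto; apply Rinv_0_lt_compat; lra).
  assert (Hbn : 1 < b * n) by (apply Rmult_lt_reg_r with (/ n); [apply Rinv_0_lt_compat; lra|]; field_simplify; lra).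
  (* small enough for the cubic lower bound of sin(n t) to keep b sin(n t) above t *)
  set (t := Rmin (/ n) ((b * n - 1) / (b * n ^ 3))).
  assert (Hn3 : 0 < b * n ^ 3) by (apply Rmult_lt_0_compat; auto; apply pow_lt; lra).
  assert (Ht0 : 0 < t).
  { apply Rmin_glb_lt; [apply Rinv_0_lt_compat|apply Rdiv_lt_0_compat]; lra. }
  assert (Ht1 : t * n <= 1).
  { apply Rle_trans with (/ n * n); [|rewrite Rinv_l; lra].
    apply Rmult_le_compat_r; [lra|apply Rmin_l]. }
  assert (Ht2 : t * (b * n ^ 3) <= b * n - 1).
  { apply Rle_trans with ((b * n - 1) / (b * n ^ 3) * (b * n ^ 3)); [|right; field; lra].
    apply Rmult_le_compat_r; [lra|apply Rmin_r]. }
  pose proof PI2_3_2.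
  assert (Ht3 : t < 1) by nra.
  pose proof (sin_lt_x t Ht0).
  pose proof (sin_gt_0 t ltac:(lra) ltac:(lra)).
  pose proof (sin_cubic_lower (n * t) ltac:(split; nra)) as Hc.
  assert (Hlt : sin t < b * sin (n * t)).
  { apply Rlt_le_trans with t; auto.
    apply Rle_trans with (b * (n * t - (n * t) ^ 3 / 6)); [|apply Rmult_le_compat_l; lra].
    replace (b * (n * t - (n * t) ^ 3 / 6)) with (t * (b * n - t * (t * (b * n ^ 3)) / 6)) by field.
    rewrite <- (Rmult_1_r t) at 1. apply Rmult_le_compat_l; [lra|].
    assert (t * (t * (b * n ^ 3)) <= 1 * (b * n - 1)); [|lra].
    apply Rmult_le_compat; try lra. apply Rmult_le_pos; lra. }
  destruct (quadratic_root_unit_disk (sin t) (a * sin (INR (1 + T) * t)) (b * sin (n * t)))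
    as (w & Hw0 & Hw1 & E); [lra|].
  apply (injective_quadratic_nonzero T a b t w); auto; try lra.
  rewrite <- E, !RtoC_mult. fold n. ring.
Qed.

(** * A discrete Cauchy formula *)

(** Fixing the carrier to C states the algebra of sums with the ring operations of C
    rather than with those of an abstract structure. *)
Definition csum (u : nat -> C) (n : nat) : C := sum_n u n.

Lemma csum_0 (u : nat -> C) : csum u 0 = u 0%nat.
Proof. exact (sum_O u). Qed.

Lemma csum_S (u : nat -> C) (n : nat) : csum u (S n) = (csum u n + u (S n))%C.
Proof. exact (sum_Sn u n). Qed.

Lemma csum_ext (u v : nat -> C) (n : nat) :
  (forall k, (k <= n)%nat -> u k = v k) -> csum u n = csum v n.
Proof. exact (sum_n_ext_loc u v n). Qed.

Lemma csum_plus (u v : nat -> C) (n : nat) :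
  csum (fun k => u k + v k)%C n = (csum u n + csum v n)%C.
Proof. exact (sum_n_plus u v n). Qed.

Lemma csum_mult_l (c : C) (u : nat -> C) (n : nat) :
  csum (fun k => c * u k)%C n = (c * csum u n)%C.
Proof. exact (sum_n_mult_l (K := C_Ring) c u n). Qed.

Lemma csum_switch (u : nat -> nat -> C) (m n : nat) :
  csum (fun i => csum (u i) n) m = csum (fun j => csum (fun i => u i j) m) n.
Proof. exact (sum_n_switch u m n). Qed.

Lemma csum_single (u : nat -> C) (k n : nat) :
  (k <= n)%nat -> (forall j, (j <= n)%nat -> j <> k -> u j = 0%C) -> csum u n = u k.
Proof.
  induction n as [|n IH]; intros Hk Hu.
  - replace k with 0%nat by lia. apply csum_0.
  - rewrite csum_S. destruct (Nat.eq_dec k (S n)) as [->|E].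
    + rewrite (csum_ext u (fun j => 0 * 0)%C).
      * rewrite csum_mult_l. ring.
      * intros j Hj. rewrite Hu by lia. ring.
    + rewrite IH by (try lia; intros; apply Hu; lia).
      rewrite (Hu (S n)) by lia. ring.
Qed.

Lemma Cmod_csum (u : nat -> C) (M : R) (n : nat) :
  (forall k, (k <= n)%nat -> Cmod (u k) <= M) -> Cmod (csum u n) <= INR (S n) * M.
Proof.
  induction n as [|n IH]; intros Hu.
  - rewrite csum_0. simpl. rewrite Rmult_1_l. auto.
  - rewrite csum_S. eapply Rle_trans; [apply Cmod_triangle|].
    rewrite (S_INR (S n)). specialize (Hu (S n) ltac:(lia)) as H1.
    specialize (IH ltac:(intros; apply Hu; lia)). lra.
Qed.

Definition geom (n : nat) (x : C) : C := csum (fun k => x ^ k)%C n.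

Lemma geom_eq (n : nat) (x : C) : ((1 - x) * geom n x = 1 - x ^ S n)%C.
Proof.
  unfold geom. induction n as [|n IH].
  - rewrite csum_0. simpl. ring.
  - rewrite csum_S, Cmult_plus_distr_l, IH, !Cpow_S. ring.
Qed.

Lemma Cmod_geom_le (n : nat) (x : C) : Cmod x <= 1 -> Cmod (geom n x) <= INR (S n).
Proof.
  intros Hx. rewrite <- (Rmult_1_r (INR (S n))). apply Cmod_csum.
  intros k _. rewrite Cmod_pow, <- (pow1 k).
  apply pow_incr. split; auto. apply Cmod_ge_0.
Qed.

Lemma Cmod_geom_lt (n : nat) (x : C) : Cmod x < 1 -> Cmod (geom n x) <= / (1 - Cmod x).
Proof.
  intros Hx. pose proof (Cmod_ge_0 x).
  assert (H1 : Cmod (geom n x) <= (1 - Cmod x ^ S n) / (1 - Cmod x)).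
  { unfold geom. induction n as [|n IH].
    - rewrite csum_0. simpl. rewrite Cmod_1. right; field; lra.
    - rewrite csum_S. eapply Rle_trans; [apply Cmod_triangle|].
      rewrite Cmod_pow. simpl pow in *.
      apply Rle_trans with ((1 - Cmod x * Cmod x ^ n) / (1 - Cmod x) + Cmod x * Cmod x ^ n).
      + lra.
      + right; field; lra. }
  eapply Rle_trans; [exact H1|]. unfold Rdiv.
  rewrite <- (Rmult_1_l (/ _)) at 2. apply Rmult_le_compat_r.
  - left; apply Rinv_0_lt_compat; lra.
  - pose proof (pow_le (Cmod x) (S n)). lra.
Qed.

(** The (n+1)-st roots of -1. Roots of -1 rather than of 1 avoid the point 1, where
    the double angle parametrisation would need the excluded angle 0. *)
Definition node (n j : nat) : C := cis (INR (2 * j + 1) * PI / INR (S n)).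

Lemma cis_neq_1 (t : R) : t <> 0 -> - PI < t < PI -> cis (2 * t) <> 1%C.
Proof.
  intros Ht0 Ht E. injection E as E _.
  assert (sin t <> 0).
  { destruct (Rtotal_order t 0) as [|[|]]; [|lra|].
    - pose proof (sin_lt_0_var t). lra.
    - pose proof (sin_gt_0 t). lra. }
  rewrite cos_2a_sin in E. nra.
Qed.

Lemma node_orthogonality (n k l : nat) :
  (k <= n)%nat -> (l <= n)%nat -> k <> l ->
  csum (fun j => node n j ^ k * Cconj (node n j) ^ l)%C n = 0%C.
Proof.
  intros Hk Hl Hkl.
  pose proof PI_RGT_0.
  assert (HN : 0 < INR (S n)) by (apply lt_0_INR; lia).
  set (th := (INR k - INR l) * PI / INR (S n)).
  assert (Hconj : forall t, Cconj (cis t) = cis (- t)).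
  { intros t. unfold Cconj, cis. simpl. rewrite cos_neg, sin_neg. auto. }
  assert (Hterm : forall j, (node n j ^ k * Cconj (node n j) ^ l = cis th * cis (2 * th) ^ j)%C).
  { intros j. unfold node. rewrite Hconj, !cis_pow, <- !cis_plus. f_equal.
    unfold th. rewrite plus_INR, mult_INR. change (INR 2) with 2. change (INR 1) with 1. field. lra. }
  rewrite (csum_ext _ _ n (fun j _ => Hterm j)), csum_mult_l.
  assert (Hne : (1 - cis (2 * th))%C <> 0%C).
  { intros E. apply (cis_neq_1 th).
    - assert (INR k <> INR l) by (apply not_INR; auto).
      unfold th. apply Rmult_integral_contrapositive; split.
      + apply Rmult_integral_contrapositive; split; lra.
      + apply Rinv_neq_0_compat; lra.
    - assert (Hd : - INR (S n) < INR k - INR l < INR (S n)).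
      { pose proof (lt_INR k (S n) ltac:(lia)). pose proof (lt_INR l (S n) ltac:(lia)).
        pose proof (pos_INR k). pose proof (pos_INR l). lra. }
      unfold th. split; apply Rmult_lt_reg_r with (INR (S n)); auto; field_simplify; try lra; nra.
    - rewrite <- (Cplus_0_r (cis (2 * th))), <- E. ring. }
  assert (Hg : geom n (cis (2 * th)) = 0%C).
  { assert (Hpow : (cis (2 * th) ^ S n)%C = 1%C).
    { rewrite cis_pow. replace (INR (S n) * (2 * th)) with (0 + 2 * INR k * PI - 2 * INR l * PI) by (unfold th; field; lra).
      unfold cis. rewrite <- (cos_period _ l), <- (sin_period _ l).
      replace (0 + 2 * INR k * PI - 2 * INR l * PI + 2 * INR l * PI) with (0 + 2 * INR k * PI) by ring.
      rewrite cos_period, sin_period, cos_0, sin_0. reflexivity. }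
    pose proof (geom_eq n (cis (2 * th))) as Hg. rewrite Hpow in Hg.
    replace (geom n (cis (2 * th))) with (/ (1 - cis (2 * th)) * ((1 - cis (2 * th)) * geom n (cis (2 * th))))%C by (field; auto).
    rewrite Hg. ring. }
  change (cis th * geom n (cis (2 * th)) = 0)%C. rewrite Hg. ring.
Qed.

(** A discrete Cauchy integral: geom n (x * Cconj y) truncates the Cauchy kernel
    1/(1 - x conj y), with an error that vanishes on polynomials of degree at
    most n. *)
Definition cauchy_sum (n : nat) (x : C) (g : C -> C) : C :=
  csum (fun j => g (node n j) * geom n (x * Cconj (node n j)))%C n.

(** Every polynomial function g of x has this property, which is all that is needed of
    them. Asking for all the multiples y^k g(y) makes the class stable under
    multiplication by y, hence by every [geom m]. *)
Definition reproduced (x : C) (g : C -> C) : Prop :=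
  forall k, exists n0, forall n, (n0 <= n)%nat ->
    cauchy_sum n x (fun y => y ^ k * g y)%C = (INR (S n) * (x ^ k * g x))%C.

Lemma cauchy_sum_monomial (n k : nat) (x : C) :
  (k <= n)%nat -> cauchy_sum n x (fun y => y ^ k)%C = (INR (S n) * x ^ k)%C.
Proof.
  intros Hk. unfold cauchy_sum, geom.
  rewrite (csum_ext _ (fun j => csum (fun l => x ^ l * (node n j ^ k * Cconj (node n j) ^ l))%C n)).
  2:{ intros j _. rewrite <- csum_mult_l. apply csum_ext. intros l _. rewrite Cpow_mult_l. ring. }
  rewrite csum_switch, (csum_single _ k n Hk).
  - rewrite csum_mult_l, Cmult_comm. f_equal.
    rewrite (csum_ext _ (fun _ => 1%C)).
    + clear. induction n as [|n IH]; [apply csum_0|].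
      rewrite csum_S, IH, (S_INR (S n)), RtoC_plus. reflexivity.
    + intros j _. rewrite <- Cpow_mult_l, <- Cmod2_conj.
      unfold node. rewrite Cmod_cis, RtoC_pow, !Cpow_1_l. auto.
  - intros l Hl Hlk. rewrite csum_mult_l, node_orthogonality by auto. ring.
Qed.

Lemma reproduced_ext (x : C) (f g : C -> C) :
  (forall y, f y = g y) -> reproduced x f -> reproduced x g.
Proof.
  intros E H k. destruct (H k) as (n0 & Hn). exists n0. intros n Hle.
  rewrite <- E, <- Hn by auto. apply csum_ext. intros j _. rewrite E. auto.
Qed.

Lemma reproduced_const (x c : C) : reproduced x (fun _ => c).
Proof.
  intros k. exists k. intros n Hn. unfold cauchy_sum.
  rewrite (csum_ext _ (fun j => c * (node n j ^ k * geom n (x * Cconj (node n j))))%C)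
    by (intros; ring).
  rewrite csum_mult_l. unfold cauchy_sum in *.
  pose proof (cauchy_sum_monomial n k x Hn) as H. unfold cauchy_sum in H.
  rewrite H. ring.
Qed.

Lemma reproduced_plus (x : C) (f g : C -> C) :
  reproduced x f -> reproduced x g -> reproduced x (fun y => f y + g y)%C.
Proof.
  intros Hf Hg k. destruct (Hf k) as (m & Hm). destruct (Hg k) as (p & Hp).
  exists (max m p). intros n Hn.
  rewrite Cmult_plus_distr_l, Cmult_plus_distr_l, <- Hm, <- Hp by lia.
  unfold cauchy_sum. rewrite <- csum_plus. apply csum_ext. intros; ring.
Qed.

Lemma reproduced_scal (x c : C) (g : C -> C) :
  reproduced x g -> reproduced x (fun y => c * g y)%C.
Proof.
  intros Hg k. destruct (Hg k) as (m & Hm). exists m. intros n Hn.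
  replace (INR (S n) * (x ^ k * (c * g x)))%C with (c * (INR (S n) * (x ^ k * g x)))%C by ring.
  rewrite <- Hm by auto. unfold cauchy_sum. rewrite <- csum_mult_l.
  apply csum_ext. intros; ring.
Qed.

Lemma reproduced_pow (x : C) (g : C -> C) (m : nat) :
  reproduced x g -> reproduced x (fun y => y ^ m * g y)%C.
Proof.
  intros Hg k. destruct (Hg (k + m)%nat) as (p & Hp). exists p. intros n Hn.
  replace (x ^ k * (x ^ m * g x))%C with (x ^ (k + m) * g x)%C by (rewrite Cpow_add_r; ring).
  rewrite <- Hp by auto.
  apply csum_ext. intros. rewrite Cpow_add_r. ring.
Qed.

Lemma reproduced_geom (x : C) (g : C -> C) (m : nat) :
  reproduced x g -> reproduced x (fun y => geom m y * g y)%C.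
Proof.
  intros Hg. induction m as [|m IH].
  - apply reproduced_ext with g; auto. intros y. unfold geom. rewrite csum_0. simpl. ring.
  - apply reproduced_ext with (fun y => geom m y * g y + y ^ S m * g y)%C.
    + intros y. unfold geom. rewrite csum_S. ring.
    + apply reproduced_plus; auto. apply reproduced_pow; auto.
Qed.

(** A substitute for the maximum principle: the kernel is at most 1/(1-|x|) in
    modulus, whatever the degree of g. *)
Theorem reproduced_bound (x : C) (g : C -> C) (M : R) :
  reproduced x g -> Cmod x < 1 ->
  (forall t, 0 < t < PI -> Cmod (g (cis (2 * t))) <= M) ->
  Cmod (g x) <= M / (1 - Cmod x).
Proof.
  intros Hg Hx HM. destruct (Hg 0%nat) as (n & Hn).
  specialize (Hn n (le_n n)).
  replace (1 * g x)%C with (g x) in Hn by ring.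
  assert (HN : 0 < INR (S n)) by (apply lt_0_INR; lia).
  apply Rmult_le_reg_l with (INR (S n)); auto.
  rewrite <- (Rabs_pos_eq (INR (S n))) at 1 by lra.
  rewrite <- Cmod_R, <- Cmod_mult.
  replace (INR (S n) * g x)%C with (INR (S n) * (x ^ 0 * g x))%C by (simpl; ring).
  rewrite <- Hn. apply Cmod_csum. intros j Hj.
  rewrite !Cmod_mult. simpl. rewrite Cmod_1, Rmult_1_l. unfold Rdiv.
  assert (Hnode : Cmod (Cconj (node n j)) = 1) by (unfold node; rewrite Cmod_conj; apply Cmod_cis).
  apply Rmult_le_compat; try apply Cmod_ge_0.
  - unfold node.
    replace (INR (2 * j + 1) * PI / INR (S n)) with (2 * (INR (2 * j + 1) * PI / (2 * INR (S n)))) by (field; lra).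
    apply HM. pose proof PI_RGT_0.
    assert (0 < INR (2 * j + 1) < 2 * INR (S n)).
    { split; [apply lt_0_INR; lia|].
      replace 2 with (INR 2) by (simpl; ring). rewrite <- mult_INR. apply lt_INR. lia. }
    split.
    + apply Rdiv_lt_0_compat; [apply Rmult_lt_0_compat|]; lra.
    + apply Rmult_lt_reg_r with (2 * INR (S n)); [lra|]. field_simplify; [|lra]. nra.
  - eapply Rle_trans; [apply Cmod_geom_lt|]; rewrite Cmod_mult, Hnode, Rmult_1_r; lra.
Qed.

(** * A coefficient condition that implies injectivity *)

(** Newton's recursion for u^k + v^k in terms of p = u + v and q = u v. It shows that
    power sums of roots are polynomials in the coefficients. *)
Fixpoint power_sum (p q : C) (k : nat) : C :=
  match k with
  | O => 2
  | S k' => match k' with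
            | O => p
            | S k'' => (p * power_sum p q k' - q * power_sum p q k'')%C
            end
  end.

Lemma power_sum_SS (p q : C) (k : nat) :
  power_sum p q (S (S k)) = (p * power_sum p q (S k) - q * power_sum p q k)%C.
Proof. reflexivity. Qed.

Lemma nat_ind2 (P : nat -> Prop) :
  P 0%nat -> P 1%nat -> (forall k, P k -> P (S k) -> P (S (S k))) -> forall k, P k.
Proof.
  intros H0 H1 HS k. cut (P k /\ P (S k)); [tauto|].
  induction k; intuition.
Qed.

Lemma power_sum_roots (u v : C) (k : nat) :
  power_sum (u + v)%C (u * v)%C k = (u ^ k + v ^ k)%C.
Proof.
  induction k using nat_ind2.
  - simpl. rewrite <- RtoC_plus. f_equal. 
  - simpl. ring.
  - rewrite power_sum_SS, IHk, IHk0, !Cpow_S. ring.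
Qed.

Lemma power_sum_scale (e p q : C) (k : nat) :
  power_sum (e * p)%C (e * e * q)%C k = (e ^ k * power_sum p q k)%C.
Proof.
  induction k using nat_ind2.
  - simpl. ring.
  - simpl. ring.
  - rewrite !power_sum_SS, IHk, IHk0, !Cpow_S. ring.
Qed.

Lemma reproduced_power_sum (x c d : C) (m n k : nat) :
  reproduced x (fun y => power_sum (c * geom m y)%C (d * geom n y)%C k).
Proof.
  induction k using nat_ind2.
  - apply (reproduced_const x 2).
  - apply (reproduced_ext x (fun y => c * (geom m y * 1))%C).
    + intros y. simpl. ring.
    + apply reproduced_scal, reproduced_geom, reproduced_const.
  - apply (reproduced_ext x (fun y =>
      c * (geom m y * power_sum (c * geom m y)%C (d * geom n y)%C (S k)) +
      (- d) * (geom n y * power_sum (c * geom m y)%C (d * geom n y)%C k))%C).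
    + intros y. rewrite power_sum_SS. ring.
    + apply reproduced_plus; apply reproduced_scal, reproduced_geom; auto.
Qed.

(** The real case of the Schur-Cohn criterion for v^2 - p v + q: nonreal roots have
    squared modulus q, and |p| <= 1 + q says that the quadratic is nonnegative at
    1 and at -1. *)
Lemma real_quadratic_roots (p q : R) :
  Rabs p <= 1 + q -> Rabs q <= 1 ->
  exists u v : C, (u + v)%C = p /\ (u * v)%C = q /\ Cmod u <= 1 /\ Cmod v <= 1.
Proof.
  intros Hp Hq. apply Rabs_le_between in Hp. apply Rabs_le_between in Hq.
  destruct (Rle_lt_dec (4 * q) (p * p)) as [Hd|Hd].
  - set (s := sqrt (p * p - 4 * q)).
    assert (Hs2 : s * s = p * p - 4 * q) by (apply sqrt_sqrt; lra).
    assert (Hs0 : 0 <= s) by apply sqrt_pos.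
    exists (RtoC ((p + s) / 2)), (RtoC ((p - s) / 2)).
    rewrite <- RtoC_plus, <- RtoC_mult, !Cmod_R.
    split; [f_equal; field|split; [f_equal|split; apply Rabs_le; split; nra]].
    replace ((p + s) / 2 * ((p - s) / 2)) with ((p * p - s * s) / 4) by field.
    rewrite Hs2. field.
  - set (s := sqrt (4 * q - p * p)).
    assert (Hs2 : s * s = 4 * q - p * p) by (apply sqrt_sqrt; lra).
    assert (Hm : forall y, y * y = s * s -> Cmod (p / 2, y / 2) <= 1).
    { intros y Hy. apply Rsqr_incr_0; [|apply Cmod_ge_0|lra].
      rewrite !Rsqr_pow2, Cmod2_alt; simpl. nra. }
    exists (p / 2, s / 2), (p / 2, (- s) / 2).
    split; [|split; [|split; apply Hm; ring]];
      unfold Cplus, Cmult, RtoC; simpl; f_equal; try field.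
    replace (p / 2 * (p / 2) - s / 2 * (- s / 2)) with ((p * p + s * s) / 4) by field.
    rewrite Hs2. field.
Qed.

(** At cis (2t) the coefficients of the collision quadratic are real up to a rotation;
    this brings in the sines of [dieudonne_condition]. *)
Lemma geom_cis (n : nat) (t : R) :
  sin t <> 0 ->
  geom n (cis (2 * t)) = (cis (INR n * t) * (sin (INR (S n) * t) / sin t)%R)%C.
Proof.
  intros Hs.
  assert (H1 : forall x, (1 - cis (2 * x) = - (2 * Ci * sin x) * cis x)%C).
  { intros x. rewrite <- cis_minus_conj, <- cis_0.
    replace (2 * x) with (x + x) by ring. replace 0 with (x + - x) by ring.
    rewrite !cis_plus. ring. }
  pose proof (geom_eq n (cis (2 * t))) as Hg.
  rewrite cis_pow in Hg.
  replace (INR (S n) * (2 * t)) with (2 * (INR (S n) * t)) in Hg by ring.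
  rewrite !H1 in Hg.
  rewrite S_INR in *. replace ((INR n + 1) * t) with (INR n * t + t) in * by ring.
  rewrite cis_plus in Hg. rewrite RtoC_div by auto.
  assert (Hne : (- (2 * Ci * sin t) * cis t)%C <> 0%C).
  { intros E. apply (f_equal Cmod) in E.
    rewrite Cmod_mult, Cmod_opp, !Cmod_mult, Cmod_cis, Cmod_Ci, !Cmod_R, Rabs_R0, (Rabs_pos_eq 2) in E by lra.
    apply Rabs_pos_lt in Hs. lra. }
  assert (Hsc : RtoC (sin t) <> 0%C) by (intros E; injection E; auto).
  replace (geom n (cis (2 * t))) with
    (/ (- (2 * Ci * sin t) * cis t) * ((- (2 * Ci * sin t) * cis t) * geom n (cis (2 * t))))%C.
  2:{ rewrite Cmult_assoc, Cinv_l, Cmult_1_l; auto. }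
  rewrite Hg. field.
  repeat split; auto; intros E; try (apply Hne; rewrite E; ring); injection E; lra.
Qed.

(** A collision F(z) = F(x z) makes v = 1/z^T, of modulus > 1, a root of
    v^2 + a geom_T(x) v + b geom_2T(x). On |x| = 1 both roots have modulus at most 1,
    so their k-th power sum is at most 2; for |x| < 1 it is bounded in k by
    [reproduced_bound]. Since the product of the roots has modulus at most 1, the
    power sums would be unbounded if a root had modulus > 1. *)
Theorem dieudonne_injective (T : nat) (a b : R) :
  (1 <= T)%nat -> Rabs b * INR (1 + 2 * T) <= 1 ->
  (forall t, 0 < t < PI ->
     Rabs (a * sin (INR (1 + T) * t)) <= sin t + b * sin (INR (1 + 2 * T) * t)) ->
  injective_on unit_disk (trinomial T a b).
Proof.
  intros HT Hb Hcond.
  set (ps := fun x k => power_sum (- a * geom T x)%C (b * geom (2 * T) x)%C k).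
  assert (Hlast : forall x, Cmod x <= 1 -> Cmod (b * geom (2 * T) x)%C <= 1).
  { intros x Hx. rewrite Cmod_mult, Cmod_R.
    eapply Rle_trans; [|exact Hb]. apply Rmult_le_compat_l; [apply Rabs_pos|].
    apply Cmod_geom_le; auto. }
  assert (Hcircle : forall t k, 0 < t < PI -> Cmod (ps (cis (2 * t)) k) <= 2).
  { intros t k Ht.
    pose proof (sin_gt_0 t (proj1 Ht) (proj2 Ht)) as Hs.
    set (p := - a * (sin (INR (S T) * t) / sin t)).
    set (q := b * (sin (INR (S (2 * T)) * t) / sin t)).
    assert (Hq1 : Rabs q <= 1).
    { specialize (Hlast (cis (2 * t)) ltac:(rewrite Cmod_cis; lra)).
      rewrite geom_cis in Hlast by lra.
      rewrite !Cmod_mult, Cmod_cis, !Cmod_R, Rmult_1_l, <- Rabs_mult in Hlast. exact Hlast. }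
    assert (Hp1 : Rabs p <= 1 + q).
    { specialize (Hcond t Ht).
      replace p with (- (a * sin (INR (1 + T) * t)) / sin t) by (unfold p; change (1 + T)%nat with (S T); field; lra).
      unfold Rdiv. rewrite Rabs_mult, Rabs_Ropp, (Rabs_pos_eq (/ sin t))
        by (left; apply Rinv_0_lt_compat; auto).
      apply Rmult_le_reg_r with (sin t); auto.
      rewrite Rmult_assoc, Rinv_l, Rmult_1_r by lra.
      eapply Rle_trans; [exact Hcond|].
      right. unfold q. change (1 + 2 * T)%nat with (S (2 * T)). field. lra. }
    destruct (real_quadratic_roots p q Hp1 Hq1) as (u & v & E1 & E2 & Hu & Hv).
    unfold ps. rewrite !geom_cis by lra.
    replace (- a * (cis (INR T * t) * (sin (INR (S T) * t) / sin t)%R))%C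
      with (cis (INR T * t) * p)%C.
    2:{ unfold p. rewrite RtoC_mult, RtoC_opp. ring. }
    replace (b * (cis (INR (2 * T) * t) * (sin (INR (S (2 * T)) * t) / sin t)%R))%C
      with (cis (INR T * t) * cis (INR T * t) * q)%C.
    2:{ unfold q. rewrite <- cis_plus, RtoC_mult.
        replace (INR (2 * T) * t) with (INR T * t + INR T * t) by (rewrite mult_INR; simpl; ring).
        ring. }
    rewrite power_sum_scale, <- E1, <- E2, power_sum_roots, Cmod_mult, Cmod_pow, Cmod_cis, pow1, Rmult_1_l.
    eapply Rle_trans; [apply Cmod_triangle|].
    rewrite !Cmod_pow.
    assert (Hpow : forall r, 0 <= r <= 1 -> r ^ k <= 1) by (intros r Hr; rewrite <- (pow1 k); apply pow_incr; auto).
    pose proof (Hpow (Cmod u) (conj (Cmod_ge_0 u) Hu)).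
    pose proof (Hpow (Cmod v) (conj (Cmod_ge_0 v) Hv)). lra. }
  (* the bound does not depend on the exponent k *)
  assert (Hbounded : forall x, Cmod x <= 1 -> x <> 1%C -> exists M, forall k, Cmod (ps x k) <= M).
  { intros x Hx Hx1. destruct (Rle_lt_or_eq_dec _ _ Hx) as [Hlt|Heq].
    - exists (2 / (1 - Cmod x)). intros k.
      apply (reproduced_bound x (fun y => ps y k)); auto.
      apply (reproduced_power_sum x (- a)%C b).
    - exists 2. intros k.
      destruct (unit_circle_cis x Heq) as (t & Ht & ->).
      replace t with (2 * (t / 2)) by field. apply Hcircle.
      destruct (Req_dec t 0) as [->|]; [|lra].
      rewrite cis_0 in Hx1. tauto. }
  assert (Hroot : forall x v : C, Cmod x <= 1 -> x <> 1%C ->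
    (v * v + a * geom T x * v + b * geom (2 * T) x = 0)%C -> Cmod v <= 1).
  { intros x v Hx Hx1 E. destruct (Rle_lt_dec (Cmod v) 1) as [|Hv]; auto. exfalso.
    destruct (Hbounded x Hx Hx1) as (M & HM).
    (* the other root *)
    set (w := (- a * geom T x - v)%C).
    assert (Hvw : (v * w = b * geom (2 * T) x)%C).
    { unfold w. rewrite <- (Cplus_0_r (v * _)), <- E. ring. }
    assert (Hw : Cmod w <= 1).
    { specialize (Hlast x Hx). rewrite <- Hvw, Cmod_mult in Hlast.
      pose proof (Cmod_ge_0 w). nra. }
    destruct (Pow_x_infinity (Cmod v)) with (b := M + 2) as (k & Hk).
    { rewrite Rabs_pos_eq; lra. }
    specialize (Hk k (le_n k)). specialize (HM k).
    assert (Hps : ps x k = (v ^ k + w ^ k)%C).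
    { unfold ps. rewrite <- Hvw, <- power_sum_roots. f_equal. unfold w. ring. }
    rewrite Rabs_pos_eq in Hk by (apply pow_le; lra).
    assert (Htri : Cmod v ^ k <= Cmod (ps x k) + Cmod w ^ k).
    { rewrite <- !Cmod_pow. replace (v ^ k)%C with (ps x k + - (w ^ k))%C by (rewrite Hps; ring).
      rewrite <- (Cmod_opp (w ^ k)). apply Cmod_triangle. }
    assert (Cmod w ^ k <= 1).
    { rewrite <- (pow1 k). apply pow_incr. split; auto. apply Cmod_ge_0. }
    lra. }
  assert (Hmain : forall z w, unit_disk z -> Cmod w <= Cmod z ->
    trinomial T a b z = trinomial T a b w -> z = w).
  { intros z w Hz Hwz E. unfold unit_disk in Hz.
    destruct (Ceq_dec z 0) as [Hz0|Hz0].
    - subst. rewrite Cmod_0 in Hwz. symmetry. apply Cmod_eq_0.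
      pose proof (Cmod_ge_0 w). lra.
    - set (x := (w / z)%C).
      assert (Hw : w = (x * z)%C) by (unfold x; field; auto).
      destruct (Ceq_dec x 1) as [Hx1|Hx1]; [rewrite Hw, Hx1; ring|].
      exfalso. pose proof (proj1 (Cmod_gt_0 z) Hz0) as Hzp.
      assert (Hx : Cmod x <= 1).
      { rewrite Hw, Cmod_mult in Hwz. nra. }
      assert (Hu : (z ^ T)%C <> 0%C) by (apply Cpow_nz; auto).
      assert (Hv : Cmod (/ z ^ T)%C <= 1).
      { apply (Hroot x); auto.
        assert (Hd : (z * ((1 - x) * (1 + a * geom T x * z ^ T + b * geom (2 * T) x * (z ^ T * z ^ T))) = 0)%C).
        { transitivity (trinomial T a b z - trinomial T a b w)%C; [|rewrite E; ring].
          replace ((1 - x) * (1 + a * geom T x * z ^ T + b * geom (2 * T) x * (z ^ T * z ^ T)))%C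
            with ((1 - x) + a * ((1 - x) * geom T x) * z ^ T + b * ((1 - x) * geom (2 * T) x) * (z ^ T * z ^ T))%C by ring.
          rewrite !geom_eq, Hw. unfold trinomial. rewrite !Cpow_mult_l.
          change (1 + 2 * T)%nat with (S (2 * T)). change (1 + T)%nat with (S T).
          replace (2 * T)%nat with (T + T)%nat by lia.
          rewrite !Cpow_S, !Cpow_add_r. ring. }
        assert (H1x : (1 - x)%C <> 0%C).
        { intros F. apply Hx1. rewrite <- (Cplus_0_r x), <- F. ring. }
        assert (Hd' : (1 + a * geom T x * z ^ T + b * geom (2 * T) x * (z ^ T * z ^ T) = 0)%C).
        { rewrite <- (Cmult_0_r (/ (1 - x))), <- (Cmult_0_r (/ z)), <- Hd. field. auto. }
        rewrite <- (Cmult_0_r (/ z ^ T * / z ^ T)), <- Hd'. field. auto. }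
      assert (Hv' : 1 < Cmod (/ z ^ T)%C); [|lra].
      rewrite Cmod_inv by auto. rewrite <- Rinv_1. apply Rinv_lt_contravar.
      + rewrite Rmult_1_r. apply Cmod_gt_0; auto.
      + rewrite Cmod_pow. apply pow_lt_1_compat; [lra|lia]. }
  intros z w Hz Hw E. unfold unit_disk in *.
  destruct (Rle_lt_dec (Cmod w) (Cmod z)); [|symmetry]; apply Hmain; auto; lra.
Qed.

(** * The extremal trinomial satisfies the condition *)

(** The ratio sin(n t)/sin t decreases as long as n t <= pi: the numerator W of its
    derivative vanishes at 0 and has derivative -(n^2-1) sin(n t) sin t. *)
Lemma sin_multiple_ratio (n x y : R) :
  1 <= n -> 0 < x -> x <= y -> n * y <= PI ->
  sin (n * y) * sin x <= sin (n * x) * sin y.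
Proof.
  intros Hn Hx Hxy Hny.
  assert (HP := PI_RGT_0).
  destruct (Rle_lt_or_eq_dec _ _ Hxy) as [Hlt| <-]; [|lra].
  destruct (Req_dec n 1) as [->|Hn1]; [rewrite !Rmult_1_l; lra|].
  assert (Hs : forall z, 0 < z -> z <= y -> 0 < sin z).
  { intros z Hz1 Hz2. apply sin_gt_0; auto. nra. }
  set (W := fun t => n * cos (n * t) * sin t - sin (n * t) * cos t).
  assert (HW : forall z, 0 < z -> z <= y -> W z <= 0).
  { intros z Hz1 Hz2.
    destruct (mean_value W (fun t => - (n * n - 1) * (sin (n * t) * sin t)) 0 z Hz1) as (u & Hu & E).
    - intros u _. unfold W. auto_derive; auto. ring.
    - assert (HW0 : W 0 = 0) by (unfold W; rewrite Rmult_0_r, sin_0; ring).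
      rewrite HW0 in E.
      assert (0 <= sin (n * u)) by (apply sin_ge_0; nra).
      assert (0 < sin u) by (apply Hs; lra).
      assert (0 <= (n * n - 1) * (sin (n * u) * sin u)) by (apply Rmult_le_pos; nra).
      nra. }
  destruct (mean_value (fun t => sin (n * t) / sin t) (fun t => W t / (sin t * sin t)) x y Hlt) as (u & Hu & E).
  { intros u Hu. assert (0 < sin u) by (apply Hs; lra).
    unfold W. auto_derive; [lra|]. field. lra. }
  assert (0 < sin u) by (apply Hs; lra).
  assert (W u / (sin u * sin u) <= 0).
  { unfold Rdiv. rewrite <- (Rmult_0_l (/ (sin u * sin u))).
    apply Rmult_le_compat_r; [left; apply Rinv_0_lt_compat; nra|apply HW; lra]. }
  assert (Hd : sin (n * y) / sin y <= sin (n * x) / sin x) by nra.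
  assert (Hsx := Hs x Hx Hxy). assert (Hsy := Hs y ltac:(lra) ltac:(lra)).
  replace (sin (n * y) * sin x) with (sin (n * y) / sin y * (sin x * sin y)) by (field; lra).
  replace (sin (n * x) * sin y) with (sin (n * x) / sin x * (sin x * sin y)) by (field; lra).
  apply Rmult_le_compat_r; nra.
Qed.

Section Extremal.

Variable T : R.
Hypothesis HT : 1 <= T.

Definition total_freq : R := 2 + 3 * T.

(** With t this angle, B takes the same value at the boundary points e^(i(pi/T + t))
    and e^(i(pi/T - t)). *)
Definition contact_angle : R := PI / total_freq.

Definition contact_cos : R := cos (T * contact_angle).
Definition extremal_b : R := (2 + T - 2 * T * contact_cos) / total_freq.
Definition extremal_a : R := extremal_b + (2 * contact_cos - 1).

(** With x = pi T/N in (0, pi/3), the lower bound is the chord of the concave function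
    cos on [0, pi/3], and the upper one uses that cos is 1-Lipschitz, with
    pi/3 - x = 2/3 of the contact angle. *)
Lemma cos_angle_bounds :
  1 - 3 * T / (2 * total_freq) <= contact_cos <= 1 / 2 + 2 * contact_angle / 3 /\ contact_cos < 1.
Proof.
  assert (HP := PI_bounds).
  assert (HN : 5 <= total_freq) by (unfold total_freq; lra).
  set (x := T * contact_angle).
  assert (Hal : 0 < contact_angle) by (apply Rdiv_lt_0_compat; lra).
  assert (HalN : contact_angle * total_freq = PI) by (unfold contact_angle; field; lra).
  assert (Hx : 0 < x < PI / 3) by (unfold x; unfold total_freq in HalN; nra).
  split; [split|].
  - destruct (mean_value cos (fun t => - sin t) 0 x) as (u & Hu & Eu); try lra.
    { intros; auto_derive; auto; ring. }
    destruct (mean_value cos (fun t => - sin t) x (PI / 3)) as (v & Hv & Ev); try lra.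
    { intros; auto_derive; auto; ring. }
    fold contact_cos in Eu, Ev. change (cos x) with contact_cos in *.
    rewrite cos_0 in Eu. rewrite cos_PI3 in Ev.
    assert (sin u <= sin v) by (apply sin_incr_1; lra).
    assert (Hsu : 0 <= sin u) by (apply sin_ge_0; lra).
    assert (Hx3 : 3 * T / (2 * total_freq) = x * (3 / (2 * PI))).
    { unfold x, contact_angle. field. lra. }
    rewrite Hx3.
    assert (Hc1 : (1 - contact_cos) * (PI / 3 - x) <= (contact_cos - 1 / 2) * x).
    { replace (1 - contact_cos) with (sin u * x) by lra.
      replace (contact_cos - 1 / 2) with (sin v * (PI / 3 - x)) by lra.
      assert (0 <= x * (PI / 3 - x)) by nra. nra. }
    apply Rmult_le_reg_r with (PI / 3); [lra|].
    replace ((1 - x * (3 / (2 * PI))) * (PI / 3)) with (PI / 3 - x / 2) by (field; lra).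
    lra.
  - destruct (mean_value cos (fun t => - sin t) x (PI / 3)) as (v & Hv & Ev); try lra.
    { intros; auto_derive; auto; ring. }
    rewrite cos_PI3 in Ev. change (cos x) with contact_cos in *.
    pose proof (SIN_bound v).
    assert (Hd : PI / 3 - x = 2 * contact_angle / 3) by (unfold x; rewrite <- HalN; unfold total_freq; field).
    rewrite Hd in Ev. nra.
  - unfold contact_cos. fold x. rewrite <- cos_0. apply cos_decreasing_1; lra.
Qed.

Lemma extremal_b_pos : 0 < extremal_b.
Proof.
  assert (HP := PI_bounds).
  assert (HN : 5 <= total_freq) by (unfold total_freq; lra).
  destruct cos_angle_bounds as [[_ Hc] _].
  apply Rdiv_lt_0_compat; [|lra].
  assert (HalN : contact_angle * (2 + 3 * T) = PI) by (unfold contact_angle, total_freq; field; lra).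
  nra.
Qed.

Lemma extremal_b_le : extremal_b * (1 + 2 * T) <= 1.
Proof.
  assert (HN : 5 <= total_freq) by (unfold total_freq; lra).
  destruct cos_angle_bounds as [[Hc _] _].
  unfold extremal_b. apply Rmult_le_reg_r with total_freq; [lra|].
  replace ((2 + T - 2 * T * contact_cos) / total_freq * (1 + 2 * T) * total_freq) with ((2 + T - 2 * T * contact_cos) * (1 + 2 * T)) by (field; lra).
  assert (Hc' : (2 * total_freq - 3 * T) <= 2 * total_freq * contact_cos).
  { apply Rmult_le_reg_r with (/ (2 * total_freq)); [apply Rinv_0_lt_compat; lra|].
    replace (2 * total_freq * contact_cos * / (2 * total_freq)) with contact_cos by (field; lra).
    replace ((2 * total_freq - 3 * T) * / (2 * total_freq)) with (1 - 3 * T / (2 * total_freq)) by (field; lra). auto. }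
  apply Rmult_le_reg_r with total_freq; [lra|]. unfold total_freq in *. nra.
Qed.

Lemma extremal_a_nonneg : 0 <= extremal_a.
Proof.
  assert (HN : 5 <= total_freq) by (unfold total_freq; lra).
  pose proof extremal_b_pos.
  destruct cos_angle_bounds as [[Hc _] _].
  assert (3 * T / (2 * total_freq) <= 1 / 2).
  { apply Rmult_le_reg_r with (2 * total_freq); [lra|]. field_simplify; [|lra]. unfold total_freq. lra. }
  unfold extremal_a. lra.
Qed.

(** With t = pi/N one has sin((1+T)t) = sin((1+2T)t), and (1+T)t differs from
    t and from (1+2T)t by the same Tt. Dividing by sin((1+T)t), the contact
    condition becomes a - b = 2c - 1. *)
Lemma sin_contact : sin ((1 + T) * contact_angle) * (2 * contact_cos - 1) = sin contact_angle.
Proof.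
  assert (HN : 5 <= total_freq) by (unfold total_freq; lra).
  assert (H1 : sin ((1 + T) * contact_angle) = sin (T * contact_angle + (1 + T) * contact_angle)).
  { rewrite <- sin_PI_x. f_equal.
    replace PI with (contact_angle * total_freq) by (unfold contact_angle; field; lra). unfold total_freq. ring. }
  assert (H2 : sin contact_angle = sin ((1 + T) * contact_angle - T * contact_angle)) by (f_equal; ring).
  rewrite sin_plus in H1. rewrite sin_minus in H2. fold contact_cos in H1, H2.
  lra.
Qed.

(** Twice the numerator of the derivative of
    (sin t + b sin((1+2T)t)) / sin((1+T)t), linearised by the product formulas. *)
Definition wronskian (t : R) : R :=
  (2 + T) * sin (T * t) - T * sin ((2 + T) * t) - extremal_b * (total_freq * sin (T * t) - T * sin (total_freq * t)).
(** The factor of the derivative of [wronskian] whose sign is not obvious. *)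
Definition wronskian_slope (t : R) : R := (2 + T) * sin t - extremal_b * total_freq * sin ((1 + 2 * T) * t).

Lemma wronskian_derive (t : R) : is_derive wronskian t (2 * T * sin ((1 + T) * t) * wronskian_slope t).
Proof.
  assert (Hprod : forall x y, cos (y - x) - cos (y + x) = 2 * sin y * sin x).
  { intros. rewrite cos_minus, cos_plus. ring. }
  assert (H1 := Hprod t ((1 + T) * t)). assert (H2 := Hprod ((1 + T) * t) ((1 + 2 * T) * t)).
  replace ((1 + T) * t - t) with (T * t) in H1 by ring.
  replace ((1 + T) * t + t) with ((2 + T) * t) in H1 by ring.
  replace ((1 + 2 * T) * t - (1 + T) * t) with (T * t) in H2 by ring.
  replace ((1 + 2 * T) * t + (1 + T) * t) with (total_freq * t) in H2 by (unfold total_freq; ring).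
  unfold wronskian, wronskian_slope. auto_derive; auto.
  transitivity (T * (2 + T) * (cos (T * t) - cos ((2 + T) * t)) - extremal_b * total_freq * T * (cos (T * t) - cos (total_freq * t))); [ring|].
  rewrite H1, H2. ring.
Qed.

Lemma wronskian_0 : wronskian 0 = 0.
Proof. unfold wronskian. rewrite !Rmult_0_r, sin_0. ring. Qed.

(** This is the equation that determines [extremal_b]. *)
Lemma wronskian_contact : wronskian contact_angle = 0.
Proof.
  assert (HN : 5 <= total_freq) by (unfold total_freq; lra).
  assert (HNal : total_freq * contact_angle = PI) by (unfold contact_angle; field; lra).
  unfold wronskian. rewrite HNal, sin_PI.
  assert (H : sin ((2 + T) * contact_angle) = 2 * sin (T * contact_angle) * contact_cos).
  { rewrite <- sin_PI_x. unfold contact_cos. rewrite <- sin_2a. f_equal. rewrite <- HNal. unfold total_freq. ring. }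
  rewrite H. unfold extremal_b. field. lra.
Qed.

(** Dividing by sin t leaves a constant minus a multiple of sin((1+2T)t)/sin t,
    which decreases until (1+2T)t = pi; after that the subtracted sine is negative. *)
Lemma wronskian_slope_persist (x y : R) :
  0 < x -> x < y -> (1 + T) * y <= PI -> 0 <= wronskian_slope x -> 0 <= wronskian_slope y.
Proof.
  intros Hx Hxy Hy HQ. assert (HP := PI_RGT_0).
  assert (HN : 5 <= total_freq) by (unfold total_freq; lra).
  pose proof extremal_b_pos as Hb.
  assert (0 < extremal_b * total_freq) by nra.
  assert (0 < sin x) by (apply sin_gt_0; nra).
  assert (0 < sin y) by (apply sin_gt_0; nra).
  unfold wronskian_slope in *.
  destruct (Rle_lt_dec ((1 + 2 * T) * y) PI) as [Hle|Hlt].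
  - pose proof (sin_multiple_ratio (1 + 2 * T) x y ltac:(lra) Hx ltac:(lra) Hle) as Hr.
    apply Rmult_le_reg_r with (sin x); auto. rewrite Rmult_0_l.
    assert (0 <= ((2 + T) * sin x - extremal_b * total_freq * sin ((1 + 2 * T) * x)) * sin y) by (apply Rmult_le_pos; lra).
    nra.
  - assert (sin ((1 + 2 * T) * y) <= 0) by (apply sin_le_0; nra).
    nra.
Qed.

(** By [wronskian_slope_persist] the function [wronskian] first decreases and then
    increases. It vanishes at 0 and at the contact angle, so it is nonpositive before
    the contact angle and nonnegative after it. *)
Lemma wronskian_sign (t : R) : 0 < t -> (1 + T) * t <= PI -> 0 <= wronskian t * (t - contact_angle).
Proof.
  intros Ht Htp. assert (HP := PI_RGT_0).
  assert (HN : 5 <= total_freq) by (unfold total_freq; lra).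
  assert (Hal : 0 < contact_angle) by (apply Rdiv_lt_0_compat; lra).
  assert (Halp : (1 + T) * contact_angle <= PI).
  { replace PI with (contact_angle * total_freq) by (unfold contact_angle; field; lra). unfold total_freq. nra. }
  assert (Hphi : forall x, 0 < x -> (1 + T) * x < PI -> 0 < 2 * T * sin ((1 + T) * x)).
  { intros x Hx1 Hx2. pose proof (sin_gt_0 ((1 + T) * x) ltac:(nra) Hx2). nra. }
  destruct (Rtotal_order t contact_angle) as [Hlt|[->|Hgt]]; [| |].
  - assert (wronskian t <= 0); [|nra].
    destruct (Rle_lt_dec (wronskian t) 0) as [|Hpos]; auto. exfalso.
    destruct (mean_value wronskian _ 0 t Ht (fun z _ => wronskian_derive z)) as (u & Hu & Eu).
    rewrite wronskian_0 in Eu.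
    assert (Hpu := Hphi u ltac:(lra) ltac:(nra)).
    assert (HQu : 0 <= wronskian_slope u).
    { destruct (Rle_lt_dec 0 (wronskian_slope u)) as [|Hn]; auto.
      assert (2 * T * sin ((1 + T) * u) * wronskian_slope u * (t - 0) < 0); [|lra].
      assert (2 * T * sin ((1 + T) * u) * wronskian_slope u < 0) by nra. nra. }
    destruct (mean_value wronskian _ t contact_angle Hlt (fun z _ => wronskian_derive z)) as (v & Hv & Ev).
    rewrite wronskian_contact in Ev.
    assert (HQv : 0 <= wronskian_slope v) by (apply (wronskian_slope_persist u v); auto; nra).
    assert (Hpv := Hphi v ltac:(lra) ltac:(nra)).
    assert (0 <= 2 * T * sin ((1 + T) * v) * wronskian_slope v * (contact_angle - t)) by (apply Rmult_le_pos; [apply Rmult_le_pos|]; lra).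
    lra.
  - nra.
  - assert (0 <= wronskian t); [|nra].
    destruct (Rle_lt_dec 0 (wronskian t)) as [|Hneg]; auto. exfalso.
    destruct (mean_value wronskian _ contact_angle t Hgt (fun z _ => wronskian_derive z)) as (u & Hu & Eu).
    rewrite wronskian_contact in Eu.
    assert (Hpu := Hphi u ltac:(lra) ltac:(nra)).
    assert (HQu : wronskian_slope u < 0).
    { destruct (Rle_lt_dec 0 (wronskian_slope u)) as [Hn|]; auto.
      assert (0 <= 2 * T * sin ((1 + T) * u) * wronskian_slope u * (t - contact_angle)); [|lra].
      apply Rmult_le_pos; [apply Rmult_le_pos|]; lra. }
    destruct (mean_value wronskian _ 0 contact_angle Hal (fun z _ => wronskian_derive z)) as (v & Hv & Ev).
    rewrite wronskian_contact, wronskian_0 in Ev.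
    assert (Hpv := Hphi v ltac:(lra) ltac:(nra)).
    assert (HQv : wronskian_slope v < 0).
    { destruct (Rle_lt_dec 0 (wronskian_slope v)) as [Hn|]; auto.
      pose proof (wronskian_slope_persist v u ltac:(lra) ltac:(lra) ltac:(nra) Hn). lra. }
    assert (2 * T * sin ((1 + T) * v) * wronskian_slope v < 0) by nra. nra.
Qed.

(** The quotient g of the right-hand side by sin((1+T)t) has a derivative of the sign of
    [wronskian], so its minimum is at the contact angle, where its value is
    [extremal_a]. *)
Lemma extremal_condition_first_arch (t : R) :
  0 < t -> (1 + T) * t < PI ->
  extremal_a * sin ((1 + T) * t) <= sin t + extremal_b * sin ((1 + 2 * T) * t).
Proof.
  intros Ht Htp. assert (HP := PI_RGT_0).
  assert (HN : 5 <= total_freq) by (unfold total_freq; lra).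
  assert (Hal : 0 < contact_angle) by (apply Rdiv_lt_0_compat; lra).
  assert (HalN : contact_angle * total_freq = PI) by (unfold contact_angle; field; lra).
  assert (Halp : (1 + T) * contact_angle < PI) by (rewrite <- HalN; unfold total_freq; nra).
  assert (Hphi : forall x, 0 < x -> (1 + T) * x < PI -> 0 < sin ((1 + T) * x)).
  { intros x Hx1 Hx2. apply sin_gt_0; nra. }
  set (g := fun x => (sin x + extremal_b * sin ((1 + 2 * T) * x)) / sin ((1 + T) * x)).
  set (g' := fun x => wronskian x / (2 * (sin ((1 + T) * x) * sin ((1 + T) * x)))).
  assert (Hg : forall x, 0 < x -> (1 + T) * x < PI -> is_derive g x (g' x)).
  { intros x Hx1 Hx2. pose proof (Hphi x Hx1 Hx2).
    unfold g, g', wronskian. auto_derive; [lra|].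
    replace (T * x) with ((1 + T) * x - x) by ring.
    replace ((2 + T) * x) with ((1 + T) * x + x) by ring.
    replace (total_freq * x) with ((1 + 2 * T) * x + (1 + T) * x) by (unfold total_freq; ring).
    assert (Hs3 : sin ((1 + T) * x - x) = sin ((1 + 2 * T) * x - (1 + T) * x)) by (f_equal; ring).
    transitivity (((2 + T) * sin ((1 + T) * x - x) - T * sin ((1 + T) * x + x) -
      extremal_b * (total_freq * sin ((1 + 2 * T) * x - (1 + T) * x) - T * sin ((1 + 2 * T) * x + (1 + T) * x))) /
      (2 * (sin ((1 + T) * x) * sin ((1 + T) * x)))).
    - rewrite !sin_plus, !sin_minus. unfold total_freq. field. lra.
    - rewrite Hs3. auto. }
  assert (Hga : g contact_angle = extremal_a).
  { unfold g. pose proof (Hphi contact_angle Hal Halp).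
    replace (sin ((1 + 2 * T) * contact_angle)) with (sin ((1 + T) * contact_angle)).
    - rewrite <- sin_contact. unfold extremal_a. field. lra.
    - rewrite <- sin_PI_x. f_equal. rewrite <- HalN. unfold total_freq. ring. }
  assert (Hg' : forall x, 0 < x -> (1 + T) * x < PI -> 0 <= g' x * (x - contact_angle)).
  { intros x Hx1 Hx2. pose proof (Hphi x Hx1 Hx2). pose proof (wronskian_sign x Hx1 ltac:(lra)).
    unfold g'.
    replace (wronskian x / (2 * (sin ((1 + T) * x) * sin ((1 + T) * x))) * (x - contact_angle))
      with (wronskian x * (x - contact_angle) * / (2 * (sin ((1 + T) * x) * sin ((1 + T) * x)))) by (field; lra).
    apply Rmult_le_pos; auto. left. apply Rinv_0_lt_compat. nra. }
  assert (Hmin : extremal_a <= g t).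
  { rewrite <- Hga. destruct (Rtotal_order t contact_angle) as [Hlt|[->|Hgt]]; [|lra|].
    - destruct (mean_value g g' t contact_angle Hlt) as (u & Hu & Eu).
      { intros; apply Hg; nra. }
      pose proof (Hg' u ltac:(lra) ltac:(nra)). nra.
    - destruct (mean_value g g' contact_angle t Hgt) as (u & Hu & Eu).
      { intros; apply Hg; nra. }
      pose proof (Hg' u ltac:(lra) ltac:(nra)). nra. }
  pose proof (Hphi t Ht Htp).
  apply Rle_trans with (g t * sin ((1 + T) * t)); [apply Rmult_le_compat_r; lra|].
  right. unfold g. field. lra.
Qed.

Lemma extremal_a_plus_b_le : 2 <= T -> extremal_a + extremal_b <= sin (PI / (1 + T)).
Proof.
  intros HT2. assert (HP := PI_bounds).
  assert (HN : 8 <= total_freq) by (unfold total_freq; lra).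
  set (x := PI / (1 + T)).
  assert (Hx : x * (1 + T) = PI) by (unfold x; field; lra).
  assert (Hx0 : 0 < x) by (apply Rdiv_lt_0_compat; lra).
  assert (Hx1 : x <= PI / 3) by nra.
  pose proof (sin_cubic_lower x ltac:(lra)) as Hs.
  eapply Rle_trans; [|exact Hs].
  destruct cos_angle_bounds as [[_ Hc] _].
  assert (HalN : contact_angle * total_freq = PI) by (unfold contact_angle; field; lra).
  assert (H1 : (extremal_a + extremal_b) * total_freq <= 4 + (4 + 2 * T) * (2 * contact_angle / 3)).
  { replace ((extremal_a + extremal_b) * total_freq) with ((2 - T) + (4 + 2 * T) * contact_cos) by (unfold extremal_a, extremal_b, total_freq; field; lra). nra. }
  (* x <= pi/3, so x^2/6 <= 0.19 *)
  assert (H2 : 81 / 100 * x <= x - x ^ 3 / 6).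
  { assert (x * x <= 11 / 10) by nra. nra. }
  eapply Rle_trans; [|exact H2].
  apply Rmult_le_reg_r with total_freq; [lra|].
  apply Rle_trans with (1 := H1).
  assert (H3 : (4 + 2 * T) * contact_angle <= PI).
  { rewrite <- HalN. unfold total_freq. assert (0 < contact_angle) by (apply Rdiv_lt_0_compat; lra). nra. }
  assert (H4 : x * total_freq = 3 * PI - x) by (rewrite <- Hx; unfold total_freq; ring).
  lra.
Qed.

(** For T = 1 the first arch covers all of (0, pi/2); for T >= 2 what is left follows
    from sin t >= sin(pi/(1+T)) >= a + b. *)
Lemma extremal_condition_half (t : R) :
  (T = 1 \/ 2 <= T) -> 0 < t -> t <= PI / 2 ->
  Rabs (extremal_a * sin ((1 + T) * t)) <= sin t + extremal_b * sin ((1 + 2 * T) * t).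
Proof.
  intros HTint Ht Ht2. assert (HP := PI_RGT_0).
  pose proof extremal_b_pos as Hb. pose proof extremal_b_le as Hb1.
  pose proof extremal_a_nonneg as Ha.
  destruct (Rlt_le_dec ((1 + T) * t) PI) as [Hlt|Hge].
  - rewrite Rabs_pos_eq.
    + apply extremal_condition_first_arch; auto.
    + apply Rmult_le_pos; auto. apply sin_ge_0; nra.
  - pose proof (SIN_bound ((1 + 2 * T) * t)). pose proof (SIN_bound ((1 + T) * t)).
    destruct HTint as [E1|HT2].
    + assert (Ht' : t = PI / 2) by (rewrite E1 in Hge; lra).
      replace ((1 + T) * t) with PI by (rewrite E1, Ht'; field).
      rewrite sin_PI, Rmult_0_r, Rabs_R0.
      replace (sin t) with 1 by (rewrite Ht', sin_PI2; auto).
      assert (extremal_b <= 1) by nra. nra.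
    + pose proof (extremal_a_plus_b_le HT2).
      assert (sin (PI / (1 + T)) <= sin t).
      { assert (PI / (1 + T) <= t).
        { apply Rmult_le_reg_r with (1 + T); [lra|]. field_simplify; lra. }
        assert (0 < PI / (1 + T)) by (apply Rdiv_lt_0_compat; lra).
        apply sin_incr_1; lra. }
      assert (Rabs (extremal_a * sin ((1 + T) * t)) <= extremal_a).
      { rewrite Rabs_mult, (Rabs_pos_eq extremal_a) by auto.
        assert (Rabs (sin ((1 + T) * t)) <= 1) by (apply Rabs_le; auto). nra. }
      nra.
Qed.

End Extremal.

Lemma INR_cases (T : nat) : (1 <= T)%nat -> 1 <= INR T /\ (INR T = 1 \/ INR T = 2 \/ 3 <= INR T).
Proof.
  intros HT. split; [apply (le_INR 1 T HT)|].
  destruct (Nat.eq_dec T 1) as [->|]; [left; auto|].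
  destruct (Nat.eq_dec T 2) as [->|]; [right; left; auto|].
  right; right. replace 3 with (INR 3) by (simpl; ring). apply le_INR. lia.
Qed.

Lemma INR_freqs (T : nat) : INR (1 + T) = 1 + INR T /\ INR (1 + 2 * T) = 1 + 2 * INR T.
Proof. rewrite !plus_INR, mult_INR. split; simpl; ring. Qed.

Lemma Rabs_sin_reflect (k : nat) (t : R) :
  Rabs (sin (INR k * (PI - t))) = Rabs (sin (INR k * t)).
Proof.
  assert (Hk : forall k, sin (INR k * PI) = 0 /\ Rabs (cos (INR k * PI)) = 1).
  { clear. induction k as [|k [IHs IHc]].
    - simpl. rewrite Rmult_0_l, sin_0, cos_0, Rabs_R1. auto.
    - rewrite S_INR. replace ((INR k + 1) * PI) with (INR k * PI + PI) by ring.
      rewrite neg_sin, neg_cos, Rabs_Ropp, IHs. split; [ring|auto]. }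
  destruct (Hk k) as [Hs Hc].
  replace (INR k * (PI - t)) with (INR k * PI - INR k * t) by ring.
  rewrite sin_minus, Hs, Rmult_0_l, Rminus_0_l, Rabs_Ropp, Rabs_mult, Hc. ring.
Qed.

Lemma sin_odd_reflect (k : nat) (t : R) :
  sin (INR (1 + 2 * k) * (PI - t)) = sin (INR (1 + 2 * k) * t).
Proof.
  rewrite (proj2 (INR_freqs k)).
  replace ((1 + 2 * INR k) * (PI - t)) with (PI - (1 + 2 * INR k) * t + 2 * INR k * PI) by ring.
  rewrite sin_period, sin_PI_x. auto.
Qed.

(** All three sines keep their modulus under t -> pi - t, and those of odd frequency
    keep their sign, so the angles up to pi/2 suffice. *)
Theorem extremal_injective (T : nat) :
  (1 <= T)%nat ->
  injective_on unit_disk (trinomial T (extremal_a (INR T)) (extremal_b (INR T))).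
Proof.
  intros HT. destruct (INR_cases T HT) as [HT1 HTc].
  destruct (INR_freqs T) as [Hf1 Hf2].
  apply dieudonne_injective; auto.
  - pose proof (extremal_b_pos (INR T) HT1).
    rewrite Rabs_pos_eq, Hf2 by lra. apply extremal_b_le; auto.
  - intros t Ht.
    assert (Hhalf : forall s, 0 < s -> s <= PI / 2 ->
      Rabs (extremal_a (INR T) * sin (INR (1 + T) * s)) <=
      sin s + extremal_b (INR T) * sin (INR (1 + 2 * T) * s)).
    { intros s Hs1 Hs2. rewrite Hf1, Hf2. apply extremal_condition_half; auto. lra. }
    destruct (Rle_lt_dec t (PI / 2)) as [Hle|Hlt]; [apply Hhalf; lra|].
    specialize (Hhalf (PI - t) ltac:(lra) ltac:(lra)).
    rewrite sin_odd_reflect, sin_PI_x, Rabs_mult, Rabs_sin_reflect, <- Rabs_mult in Hhalf.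
    exact Hhalf.
Qed.

(** * The modulus of a trinomial on the unit circle *)

(** |1 + a w + b w^2|^2 for |w| = 1 and x = Re w, written as the squared modulus of
    conj w + a + b w. *)
Definition circle_form (a b x : R) : R := (a + (1 + b) * x) ^ 2 + (1 - b) ^ 2 * (1 - x ^ 2).

(** Factor out the unimodular z w from F(z), where w = z^T: what is left is
    conj w + a + b w. *)
Lemma Cmod_trinomial_cis (T : nat) (a b t : R) :
  Cmod (trinomial T a b (cis t)) = sqrt (circle_form a b (cos (INR T * t))).
Proof.
  set (th := INR T * t).
  assert (H : trinomial T a b (cis t) =
    (cis t * cis th * (a + (1 + b) * cos th, - (1 - b) * sin th)%R)%C).
  { unfold trinomial. rewrite !cis_pow.
    replace (INR (1 + T) * t) with (t + th) by (unfold th; rewrite plus_INR; simpl; ring).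
    replace (INR (1 + 2 * T) * t) with (t + th + th) by (unfold th; rewrite plus_INR, mult_INR; simpl; ring).
    replace (cis t) with (cis t * (cis th * cis (- th)))%C at 1.
    2:{ rewrite <- cis_plus, Rplus_opp_r, cis_0. ring. }
    rewrite !cis_plus.
    replace ((a + (1 + b) * cos th, - (1 - b) * sin th)%R : C) with (cis (- th) + a + b * cis th)%C.
    - ring.
    - unfold cis, RtoC, Cplus, Cmult; simpl. rewrite cos_neg, sin_neg. f_equal; ring. }
  rewrite H, !Cmod_mult, !Cmod_cis, !Rmult_1_l. unfold Cmod, circle_form; simpl fst; simpl snd.
  f_equal. pose proof (sin2_cos2 th) as Hsc. unfold Rsqr in Hsc.
  replace ((- (1 - b) * sin th) ^ 2) with ((1 - b) ^ 2 * (sin th * sin th)) by ring.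
  replace (sin th * sin th) with (1 - cos th ^ 2) by (simpl; lra). ring.
Qed.

Lemma circle_min_exists (T : nat) (a b : R) (F : C -> C) :
  (forall z, F z = trinomial T a b z) -> exists m, is_circle_min F m.
Proof.
  intros HF. assert (HP := PI_RGT_0).
  destruct (continuity_ab_min (fun t => circle_form a b (cos (INR T * t))) 0 (2 * PI))
    as (t0 & Hmin & Ht0).
  - lra.
  - intros t _. unfold circle_form. reg.
  - exists (Cmod (F (cis t0))). split.
    + exists (cis t0). split; auto. apply Cmod_cis.
    + intros x (z & Hz & ->). destruct (unit_circle_cis z Hz) as (t & Ht & ->).
      rewrite !HF, !Cmod_trinomial_cis. apply sqrt_le_1_alt, Hmin. lra.
Qed.

(** C carries two normed module structures, and the product rule is stated for the
    one induced by the absolute ring C. Their algebra and norms agree by conversion. *)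
Lemma ex_derive_C_normed (f : C -> C) (z : C) :
  @ex_derive C_AbsRing (AbsRing_NormedModule C_AbsRing) f z ->
  @ex_derive C_AbsRing C_NormedModule f z.
Proof.
  intros [l [[H1 H2 H3] H4]]. exists l.
  split; [split; [exact H1|exact H2|exact H3]|exact H4].
Qed.

Lemma ex_derive_C_mult (f g : C -> C) (z : C) :
  @ex_derive C_AbsRing (AbsRing_NormedModule C_AbsRing) f z ->
  @ex_derive C_AbsRing (AbsRing_NormedModule C_AbsRing) g z ->
  @ex_derive C_AbsRing (AbsRing_NormedModule C_AbsRing) (fun x => (f x * g x)%C) z.
Proof.
  intros [df Hf] [dg Hg]. eexists.
  exact (@is_derive_mult C_AbsRing f g z df dg Hf Hg Cmult_comm).
Qed.

Lemma ex_derive_C_pow (n : nat) (z : C) :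
  @ex_derive C_AbsRing (AbsRing_NormedModule C_AbsRing) (fun x => (x ^ n)%C) z.
Proof.
  induction n as [|n IH].
  - exact (@ex_derive_const C_AbsRing (AbsRing_NormedModule C_AbsRing) (RtoC 1) z).
  - apply (ex_derive_C_mult (fun x => x) (fun x => x ^ n)%C); auto.
    apply (@ex_derive_id C_AbsRing).
Qed.

Lemma trinomial_holomorphic (T : nat) (a b : R) (D : C -> Prop) :
  holomorphic_on D (trinomial T a b).
Proof.
  intros z _. apply ex_derive_C_normed. unfold trinomial.
  apply (@ex_derive_plus C_AbsRing (AbsRing_NormedModule C_AbsRing)
    (fun z => z + a * z ^ (1 + T))%C (fun z => b * z ^ (1 + 2 * T))%C).
  - apply (@ex_derive_plus C_AbsRing (AbsRing_NormedModule C_AbsRing)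
      (fun z => z) (fun z => a * z ^ (1 + T))%C).
    + apply (@ex_derive_id C_AbsRing).
    + apply (ex_derive_C_mult (fun _ => a)); [|apply ex_derive_C_pow].
      exact (@ex_derive_const C_AbsRing (AbsRing_NormedModule C_AbsRing) (RtoC a) z).
  - apply (ex_derive_C_mult (fun _ => b)); [|apply ex_derive_C_pow].
    exact (@ex_derive_const C_AbsRing (AbsRing_NormedModule C_AbsRing) (RtoC b) z).
Qed.

(** * The lower bound for admissible coefficients *)

(** For b <= 0 the form is concave in x, so its minimum is at an end point. For b > 0
    it is convex with vertex at -a(1+b)/(4b): a vertex left of -1 leaves x = -1 as
    the minimum, otherwise the value (1-b)^2 (1 - a^2/(4b)) at the vertex counts. *)
Lemma circle_form_lower (a b m x : R) :
  0 <= a -> 0 <= m -> m <= 1 + b - a ->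
  (0 < b -> a * (1 + b) <= 4 * b -> m ^ 2 * (4 * b) <= (1 - b) ^ 2 * (4 * b - a ^ 2)) ->
  -1 <= x <= 1 -> m ^ 2 <= circle_form a b x.
Proof.
  intros Ha Hm Hend Hint Hx. unfold circle_form.
  assert (H1 : m ^ 2 <= (1 + b - a) ^ 2) by (apply pow_incr; lra).
  assert (H2 : m ^ 2 <= (1 + b + a) ^ 2) by (apply pow_incr; lra).
  destruct (Rle_lt_dec b 0) as [Hb|Hb].
  - replace ((a + (1 + b) * x) ^ 2 + (1 - b) ^ 2 * (1 - x ^ 2)) with
      ((1 + b - a) ^ 2 * ((1 - x) / 2) + (1 + b + a) ^ 2 * ((1 + x) / 2) + 4 * (- b) * ((1 - x) * (1 + x))) by field.
    assert (0 <= 4 * - b * ((1 - x) * (1 + x))) by (apply Rmult_le_pos; [lra|apply Rmult_le_pos; lra]).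
    nra.
  - destruct (Rle_lt_dec (4 * b) (a * (1 + b))) as [Hab|Hab].
    + replace ((a + (1 + b) * x) ^ 2 + (1 - b) ^ 2 * (1 - x ^ 2)) with
        ((1 + b - a) ^ 2 + (x + 1) * (4 * b * (x + 1) + 2 * (a * (1 + b) - 4 * b))) by ring.
      assert (0 <= (x + 1) * (4 * b * (x + 1) + 2 * (a * (1 + b) - 4 * b))); [|lra].
      apply Rmult_le_pos; [lra|]. assert (0 <= 4 * b * (x + 1)) by (apply Rmult_le_pos; lra). lra.
    + specialize (Hint Hb ltac:(lra)).
      apply Rmult_le_reg_r with (4 * b); [lra|].
      replace (((a + (1 + b) * x) ^ 2 + (1 - b) ^ 2 * (1 - x ^ 2)) * (4 * b)) with
        ((4 * b * x + a * (1 + b)) ^ 2 + (1 - b) ^ 2 * (4 * b - a ^ 2)) by ring.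
      pose proof (pow2_ge_0 (4 * b * x + a * (1 + b))). lra.
Qed.

(** The vertex lies in the interval, so a <= 4b/(1+b) and the value there is at least
    ((1-b)^2/(1+b))^2, which decreases in b. *)
Lemma interior_bound_below (a b p m : R) :
  0 <= a -> 0 < b <= p -> p <= 1 -> 0 <= m -> m * (1 + p) <= (1 - p) ^ 2 ->
  a * (1 + b) <= 4 * b -> m ^ 2 * (4 * b) <= (1 - b) ^ 2 * (4 * b - a ^ 2).
Proof.
  intros Ha Hb Hp Hm Hmp Hab.
  assert (Hmb : m * (1 + b) <= (1 - b) ^ 2) by nra.
  apply Rmult_le_reg_r with ((1 + b) ^ 2); [nra|].
  assert (Ha2 : (a * (1 + b)) ^ 2 <= (4 * b) ^ 2) by (apply pow_incr; nra).
  assert (Hm2 : (m * (1 + b)) ^ 2 <= ((1 - b) ^ 2) ^ 2) by (apply pow_incr; nra).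
  apply Rle_trans with (((1 - b) ^ 2) ^ 2 * (4 * b)).
  - replace (m ^ 2 * (4 * b) * (1 + b) ^ 2) with ((m * (1 + b)) ^ 2 * (4 * b)) by ring.
    apply Rmult_le_compat_r; lra.
  - replace ((1 - b) ^ 2 * (4 * b - a ^ 2) * (1 + b) ^ 2) with
      ((1 - b) ^ 2 * (4 * b * (1 + b) ^ 2 - (a * (1 + b)) ^ 2)) by ring.
    replace (((1 - b) ^ 2) ^ 2 * (4 * b)) with
      ((1 - b) ^ 2 * (4 * b * (1 + b) ^ 2 - (4 * b) ^ 2)) by ring.
    apply Rmult_le_compat_l; [apply pow2_ge_0|lra].
Qed.

(** With a replaced by its bound (1+b)K the value at the vertex is a function of b
    that takes at p the value ((1-p)^2/(1+p))^2, by the choice of K. By the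
    hypothesis on q its values on [p, q] are at least the one at p. *)
Lemma interior_bound_above (a b p q K m : R) :
  0 <= a -> 0 < p <= b -> b <= q -> q <= 1 / 2 -> 0 <= m ->
  m * (1 + p) <= (1 - p) ^ 2 -> K * (1 + p) ^ 2 = 4 * p ->
  (2 - p - q) * q * (1 + p) ^ 4 <= 4 * p ->
  a <= (1 + b) * K -> m ^ 2 * (4 * b) <= (1 - b) ^ 2 * (4 * b - a ^ 2).
Proof.
  intros Ha Hpb Hbq Hq Hm Hmp HK Hgrow Hab.
  assert (HK0 : 0 <= K) by nra.
  assert (Ha2 : a ^ 2 <= ((1 + b) * K) ^ 2) by (apply pow_incr; lra).
  apply Rle_trans with ((1 - b) ^ 2 * (4 * b - ((1 + b) * K) ^ 2)).
  2:{ apply Rmult_le_compat_l; [apply pow2_ge_0|lra]. }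
  assert (Hm2 : (m * (1 + p)) ^ 2 <= ((1 - p) ^ 2) ^ 2) by (apply pow_incr; nra).
  assert (Hvp : m ^ 2 * (4 * p) <= (1 - p) ^ 2 * (4 * p - ((1 + p) * K) ^ 2)).
  { apply Rmult_le_reg_r with ((1 + p) ^ 2); [nra|].
    replace ((1 - p) ^ 2 * (4 * p - ((1 + p) * K) ^ 2) * (1 + p) ^ 2) with
      ((1 - p) ^ 2 * (4 * p * (1 + p) ^ 2 - (K * (1 + p) ^ 2) ^ 2)) by ring.
    rewrite HK.
    replace (m ^ 2 * (4 * p) * (1 + p) ^ 2) with ((m * (1 + p)) ^ 2 * (4 * p)) by ring.
    replace ((1 - p) ^ 2 * (4 * p * (1 + p) ^ 2 - (4 * p) ^ 2)) with (((1 - p) ^ 2) ^ 2 * (4 * p)) by ring.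
    apply Rmult_le_compat_r; lra. }
  assert (Hgb : (2 - p - b) * b * (4 * p) <= K ^ 2).
  { assert (H1 : (2 - p - b) * b <= (2 - p - q) * q) by nra.
    assert (H4 : 0 < (1 + p) ^ 4) by (apply pow_lt; lra).
    apply Rmult_le_reg_r with ((1 + p) ^ 4); auto.
    replace (K ^ 2 * (1 + p) ^ 4) with ((K * (1 + p) ^ 2) ^ 2) by ring. rewrite HK.
    assert ((2 - p - b) * b * (1 + p) ^ 4 <= (2 - p - q) * q * (1 + p) ^ 4) by (apply Rmult_le_compat_r; lra).
    replace ((2 - p - b) * b * (4 * p) * (1 + p) ^ 4) with ((2 - p - b) * b * (1 + p) ^ 4 * (4 * p)) by ring.
    replace ((4 * p) ^ 2) with (4 * p * (4 * p)) by ring.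
    apply Rmult_le_compat_r; lra. }
  apply Rmult_le_reg_r with p; [lra|].
  apply Rle_trans with ((1 - p) ^ 2 * (4 * p - ((1 + p) * K) ^ 2) * b).
  { replace (m ^ 2 * (4 * b) * p) with (m ^ 2 * (4 * p) * b) by ring.
    apply Rmult_le_compat_r; lra. }
  assert (Hdiff : (1 - b) ^ 2 * (4 * b - ((1 + b) * K) ^ 2) * p - (1 - p) ^ 2 * (4 * p - ((1 + p) * K) ^ 2) * b
    = (b - p) * ((K ^ 2 - (2 - p - b) * b * (4 * p)) + K ^ 2 * (p * b) * (2 - (p * p + p * b + b * b)))) by ring.
  assert (0 <= (b - p) * ((K ^ 2 - (2 - p - b) * b * (4 * p)) + K ^ 2 * (p * b) * (2 - (p * p + p * b + b * b)))); [|lra].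
  apply Rmult_le_pos; [lra|]. apply Rplus_le_le_0_compat; [lra|].
  clear - Hpb Hbq Hq.
  apply Rmult_le_pos; [|nra]. apply Rmult_le_pos; [apply pow2_ge_0|nra].
Qed.

Section LowerBound.

Variables T a b : R.
Hypothesis HT : 1 <= T.
Hypothesis Ha : 0 <= a.
Hypothesis Hb : b <= / (1 + 2 * T).
Hypothesis Hcond : forall t, 0 < t < PI ->
  a * sin ((1 + T) * t) <= sin t + b * sin ((1 + 2 * T) * t).

(** The radius of the largest disk about 0 in the image of B. *)
Definition koebe_radius : R := 2 - 2 * contact_cos T.

Lemma koebe_radius_pos : 0 < koebe_radius.
Proof. destruct (cos_angle_bounds T HT) as [_ H]. unfold koebe_radius. lra. Qed.

(** The hypothesis at the contact angle, where sin((1+T)t) = sin((1+2T)t), reads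
    a <= b + 2c - 1. *)
Lemma endpoint_bound : koebe_radius <= 1 + b - a.
Proof.
  assert (HP := PI_RGT_0).
  set (al := contact_angle T).
  assert (HalN : al * (2 + 3 * T) = PI) by (unfold al, contact_angle, total_freq; field; lra).
  assert (Hal : 0 < al) by nra.
  assert (Hs : 0 < sin ((1 + T) * al)) by (apply sin_gt_0; nra).
  specialize (Hcond al ltac:(split; nra)).
  assert (Hct : sin ((1 + T) * al) * (2 * contact_cos T - 1) = sin al) by apply (sin_contact T HT).
  rewrite <- Hct in Hcond.
  replace (sin ((1 + 2 * T) * al)) with (sin ((1 + T) * al)) in Hcond.
  2:{ rewrite <- sin_PI_x. f_equal. rewrite <- HalN. ring. }
  apply Rmult_le_reg_l with (sin ((1 + T) * al)); auto.
  unfold koebe_radius. nra.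
Qed.

(** At t = pi/(2(1+T)) the middle sine is 1 and the last one equals sin t. *)
Lemma quarter_wave_bound : a <= (1 + b) * sin (PI / (2 * (1 + T))).
Proof.
  assert (HP := PI_RGT_0).
  set (t := PI / (2 * (1 + T))).
  assert (Ht : t * (2 * (1 + T)) = PI) by (unfold t; field; lra).
  specialize (Hcond t ltac:(split; nra)).
  replace ((1 + T) * t) with (PI / 2) in Hcond by lra.
  rewrite sin_PI2 in Hcond.
  replace (sin ((1 + 2 * T) * t)) with (sin t) in Hcond.
  2:{ rewrite <- sin_PI_x. f_equal. rewrite <- Ht. ring. }
  lra.
Qed.

(** The hypothesis at the angle with cos^2 t = (1-b)/(4b), the best one for given b,
    yields a^2 <= 4b(1-b). The value at the vertex is then at least (1-b)^2 b, which
    increases on [0, 1/3]. *)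
Lemma interior_bound_T1 : T = 1 -> 0 < b -> a * (1 + b) <= 4 * b ->
  koebe_radius ^ 2 * (4 * b) <= (1 - b) ^ 2 * (4 * b - a ^ 2).
Proof.
  intros E Hb0 Hab. assert (HP := PI_RGT_0).
  assert (Hb1 : b <= 1 / 3) by (rewrite E in Hb; lra).
  pose proof koebe_radius_pos as Hm0.
  assert (Hm : koebe_radius <= 0.3824).
  { unfold koebe_radius.
    destruct (cos_angle_bounds T HT) as [[Hc1 _] _].
    assert (Hc2 : 1 / 2 < contact_cos T).
    { eapply Rlt_le_trans; [|exact Hc1]. unfold total_freq. rewrite E. lra. }
    assert (Hq : 2 * contact_cos T * (2 * contact_cos T - 1) = 1).
    { pose proof (sin_contact T HT) as Hs.
      assert (HalN : contact_angle T * 5 = PI) by (unfold contact_angle, total_freq; rewrite E; field).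
      assert (0 < sin (contact_angle T)) by (apply sin_gt_0; lra).
      assert (Hprod : contact_cos T = cos (contact_angle T)) by (unfold contact_cos; f_equal; rewrite E; ring).
      replace ((1 + T) * contact_angle T) with (2 * contact_angle T) in Hs by (rewrite E; ring).
      rewrite sin_2a, <- Hprod in Hs. nra. }
    nra. }
  (* 0.296 separates the ranges where the two estimates of the vertex value exceed
     the square of the radius, 0.1459; both have a margin below one percent. *)
  destruct (Rle_lt_dec b 0.296) as [Hsm|Hlg].
  - apply (interior_bound_below a b 0.296); lra.
  - set (C := sqrt ((1 - b) / (4 * b))).
    assert (HC2 : C * C = (1 - b) / (4 * b)).
    { apply sqrt_sqrt. left; apply Rdiv_lt_0_compat; lra. }
    assert (HC2' : C * C * (4 * b) = 1 - b) by (rewrite HC2; field; lra).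
    assert (HC0 : 0 < C) by (apply sqrt_lt_R0, Rdiv_lt_0_compat; lra).
    assert (HC1 : C < 1) by nra.
    pose proof (acos_bound_lt C ltac:(lra)) as Ht.
    specialize (Hcond (acos C) Ht).
    pose proof (sin_gt_0 (acos C) (proj1 Ht) (proj2 Ht)) as Hs.
    replace ((1 + T) * acos C) with (2 * acos C) in Hcond by (rewrite E; ring).
    replace ((1 + 2 * T) * acos C) with (2 * acos C + acos C) in Hcond by (rewrite E; ring).
    rewrite sin_plus, sin_2a, cos_2a_cos, cos_acos in Hcond by lra.
    assert (HaC : a * C <= 1 - b).
    { apply Rmult_le_reg_l with (2 * sin (acos C)); [lra|].
      eapply Rle_trans; [|eapply Rle_trans; [exact Hcond|]]; [right; ring|].
      replace (sin (acos C) + b * (2 * sin (acos C) * C * C + (2 * C * C - 1) * sin (acos C)))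
        with (sin (acos C) * (1 - b + C * C * (4 * b))) by ring.
      rewrite HC2'. right; ring. }
    assert (Ha2 : a ^ 2 <= 4 * b * (1 - b)).
    { assert (Haa : (a * C) ^ 2 <= (1 - b) ^ 2) by (apply pow_incr; nra).
      replace ((a * C) ^ 2) with (a ^ 2 * (C * C)) in Haa by ring.
      rewrite HC2 in Haa.
      apply Rmult_le_reg_r with ((1 - b) / (4 * b)); [apply Rdiv_lt_0_compat; lra|].
      eapply Rle_trans; [exact Haa|]. right; field; lra. }
    assert (Hmb : koebe_radius ^ 2 <= (1 - b) ^ 2 * b).
    { apply Rle_trans with ((1 - 0.296) ^ 2 * 0.296).
      - apply Rle_trans with (0.3824 ^ 2); [apply pow_incr|]; lra.
      - assert (H3 : 0 <= (b - 0.296) * (1 - 2 * (b + 0.296) + (b * b + 0.296 * b + 0.296 * 0.296))).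
        { apply Rmult_le_pos; [lra|]. clear - Hlg Hb1. nra. }
        lra. }
    apply Rle_trans with ((1 - b) ^ 2 * b * (4 * b)).
    + apply Rmult_le_compat_r; lra.
    + replace ((1 - b) ^ 2 * b * (4 * b)) with ((1 - b) ^ 2 * (4 * b - 4 * b * (1 - b))) by ring.
      apply Rmult_le_compat_l; [apply pow2_ge_0|lra].
Qed.

(** The two estimates of the vertex value meet at b = p: below p the position of the
    vertex bounds a, above p [quarter_wave_bound] does. *)
Lemma interior_bound_split (p : R) :
  0 < p -> p <= 1 ->
  koebe_radius * (1 + p) <= (1 - p) ^ 2 ->
  sin (PI / (2 * (1 + T))) * (1 + p) ^ 2 <= 4 * p ->
  (2 - p - / (1 + 2 * T)) * / (1 + 2 * T) * (1 + p) ^ 4 <= 4 * p ->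
  0 < b -> a * (1 + b) <= 4 * b ->
  koebe_radius ^ 2 * (4 * b) <= (1 - b) ^ 2 * (4 * b - a ^ 2).
Proof.
  intros Hp Hp1 Hm Hk Hgrow Hb0 Hab.
  pose proof koebe_radius_pos.
  assert (Hq : / (1 + 2 * T) <= 1 / 2).
  { apply Rmult_le_reg_r with (1 + 2 * T); [lra|]. rewrite Rinv_l; lra. }
  destruct (Rle_lt_dec b p) as [Hsm|Hlg].
  - apply (interior_bound_below a b p); lra.
  - apply (interior_bound_above a b p (/ (1 + 2 * T)) (4 * p / (1 + p) ^ 2)); try lra.
    + field. lra.
    + pose proof quarter_wave_bound.
      assert (sin (PI / (2 * (1 + T))) <= 4 * p / (1 + p) ^ 2).
      { apply Rmult_le_reg_r with ((1 + p) ^ 2); [nra|].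
        replace (4 * p / (1 + p) ^ 2 * (1 + p) ^ 2) with (4 * p) by (field; lra). auto. }
      nra.
Qed.

(** Here the first two conditions on p in [interior_bound_split] hold with equality, so
    p = 3 - 2 sqrt 2 is the only choice. *)
Lemma interior_bound_T2 : T = 2 -> 0 < b -> a * (1 + b) <= 4 * b ->
  koebe_radius ^ 2 * (4 * b) <= (1 - b) ^ 2 * (4 * b - a ^ 2).
Proof.
  intros E. set (r := sqrt 2).
  assert (Hr2 : r * r = 2) by (apply sqrt_sqrt; lra).
  assert (Hr0 : 0 <= r) by apply sqrt_pos.
  assert (Hr1 : 1.414 < r < 1.415) by nra.
  assert (Hc : contact_cos T = r / 2).
  { unfold contact_cos, contact_angle, total_freq. rewrite E.
    replace (2 * (PI / (2 + 3 * 2))) with (PI / 4) by field.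
    rewrite cos_PI4. fold r. apply Rmult_eq_reg_l with r; [|lra].
    replace (r * (r / 2)) with (r * r / 2) by field. rewrite Hr2. field. lra. }
  apply (interior_bound_split (3 - 2 * r)); try lra.
  - unfold koebe_radius. rewrite Hc. nra.
  - replace (PI / (2 * (1 + T))) with (PI / 6) by (rewrite E; field).
    rewrite sin_PI6. nra.
  - rewrite E.
    replace ((1 + (3 - 2 * r)) ^ 4) with ((24 - 16 * r) ^ 2).
    2:{ replace (24 - 16 * r) with ((1 + (3 - 2 * r)) ^ 2); [ring|].
        replace ((1 + (3 - 2 * r)) ^ 2) with (16 - 16 * r + 4 * (r * r)) by ring. rewrite Hr2; ring. }
    replace ((24 - 16 * r) ^ 2) with (1088 - 768 * r).
    2:{ replace ((24 - 16 * r) ^ 2) with (576 - 768 * r + 256 * (r * r)) by ring. rewrite Hr2; ring. }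
    nra.
Qed.

(** The first two conditions on p leave a narrow window around a reciprocal of an affine
    function of T; p = 1/D lies in it. After Taylor bounds each condition is a
    polynomial in u = T - 3 with positive coefficients. *)
Lemma interior_bound_T3 : 3 <= T -> 0 < b -> a * (1 + b) <= 4 * b ->
  koebe_radius ^ 2 * (4 * b) <= (1 - b) ^ 2 * (4 * b - a ^ 2).
Proof.
  intros HT3. assert (HP := PI_bounds).
  set (u := T - 3). assert (Hu : 0 <= u) by (unfold u; lra).
  assert (ET : T = u + 3) by (unfold u; ring).
  assert (Hpow : 0 <= u ^ 2 /\ 0 <= u ^ 3 /\ 0 <= u ^ 4 /\ 0 <= u ^ 5 /\ 0 <= u ^ 6)
    by (repeat split; apply pow_le; auto).
  (* D = 5/2 (1+T) - 1.68: for large T any slope between about 2.481 and 2.547 works,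
     and 8.32 lies in the window [8.30, 8.33] of T = 3. *)
  set (D := 5 / 2 * u + 8.32).
  assert (HD : 8.32 <= D) by (unfold D; lra).
  assert (HpD : / D * D = 1) by (field; lra).
  apply (interior_bound_split (/ D)).
  - apply Rinv_0_lt_compat; lra.
  - apply Rmult_le_reg_r with D; lra.
  (* e is just below 2 pi/(3N), and pi T/N = pi/3 - 2 pi/(3N). *)
  - set (e := 2.094333 / total_freq T).
    assert (HN : total_freq T = 3 * u + 11) by (unfold total_freq; lra).
    assert (He : e * (3 * u + 11) = 2.094333) by (unfold e; rewrite HN; field; lra).
    assert (He0 : 0 < e) by (unfold e; apply Rdiv_lt_0_compat; lra).
    assert (Hal : contact_angle T * (3 * u + 11) = PI).
    { unfold contact_angle. rewrite HN. field. lra. }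
    assert (Hc : cos (PI / 3 - e) <= contact_cos T).
    { unfold contact_cos. apply cos_decr_1; nra. }
    rewrite cos_minus, cos_PI3, sin_PI3 in Hc.
    assert (Hs3 : 1.73205 <= sqrt 3).
    { assert (sqrt 3 * sqrt 3 = 3) by (apply sqrt_sqrt; lra). pose proof (sqrt_pos 3). nra. }
    assert (He1 : e <= 1 / 5) by nra.
    pose proof (cos_quadratic_lower e ltac:(lra)).
    pose proof (sin_cubic_lower e ltac:(lra)).
    assert (Hms : koebe_radius <= 1 + e ^ 2 / 2 - 1.73205 * (e - e ^ 3 / 6)).
    { unfold koebe_radius. assert (0 <= sin e) by (apply sin_ge_0; lra). nra. }
    apply Rle_trans with ((1 + e ^ 2 / 2 - 1.73205 * (e - e ^ 3 / 6)) * (1 + / D)).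
    { apply Rmult_le_compat_r; [|auto]. assert (0 < / D) by (apply Rinv_0_lt_compat; lra). lra. }
    replace e with (2.094333 / (3 * u + 11)) by (rewrite <- He; field; lra).
    apply Rmult_le_reg_r with (D ^ 2 * (3 * u + 11) ^ 3).
    { apply Rmult_lt_0_compat; apply pow_lt; lra. }
    field_simplify; [|lra|lra]. unfold D. lra.
  (* x is just above pi/(2(1+T)). *)
  - set (x := 1.5708 / (u + 4)).
    assert (Hx : x * (u + 4) = 1.5708) by (unfold x; field; lra).
    assert (Hx0 : 0 < x) by (unfold x; apply Rdiv_lt_0_compat; lra).
    assert (Hx1 : x <= 1) by nra.
    assert (Hs : sin (PI / (2 * (1 + T))) <= sin x).
    { assert (Hy : PI / (2 * (1 + T)) * (u + 4) = PI / 2) by (rewrite ET; field; lra).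
      apply sin_incr_1; nra. }
    apply Rle_trans with ((x - x ^ 3 / 6 + x ^ 5 / 120) * (1 + / D) ^ 2).
    { apply Rmult_le_compat_r; [apply pow2_ge_0|].
      eapply Rle_trans; [exact Hs|apply sin_quintic_upper; lra]. }
    unfold x.
    apply Rmult_le_reg_r with (D ^ 2 * (u + 4) ^ 5).
    { apply Rmult_lt_0_compat; apply pow_lt; lra. }
    field_simplify; [|lra|lra]. unfold D. lra.
  - assert (Hq : / (1 + 2 * T) * (2 * u + 7) = 1) by (rewrite ET; field; lra).
    assert (Hq0 : 0 < / (1 + 2 * T)) by nra.
    assert (Hp0 : 0 < / D) by nra.
    apply Rle_trans with (2 * / (1 + 2 * T) * (1 + / D) ^ 4).
    { apply Rmult_le_compat_r; [apply pow_le; lra|]. nra. }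
    replace (/ (1 + 2 * T)) with (/ (2 * u + 7)) by (f_equal; lra).
    apply Rmult_le_reg_r with (D ^ 4 * (2 * u + 7)).
    { apply Rmult_lt_0_compat; [apply pow_lt|]; lra. }
    field_simplify; [|lra|lra]. unfold D. lra.
Qed.

Theorem circle_form_koebe (x : R) :
  T = 1 \/ T = 2 \/ 3 <= T -> -1 <= x <= 1 -> koebe_radius ^ 2 <= circle_form a b x.
Proof.
  intros HTint Hx. apply circle_form_lower; auto.
  - left; apply koebe_radius_pos.
  - apply endpoint_bound.
  - destruct HTint as [|[|]]; [apply interior_bound_T1|apply interior_bound_T2|apply interior_bound_T3]; auto.
Qed.

End LowerBound.

(** The form is unchanged under (a, x) -> (-a, -x), so a may be taken nonnegative. *)
Theorem univalent_trinomial_koebe (T : nat) (a b : R) (z : C) :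
  (1 <= T)%nat -> injective_on unit_disk (trinomial T a b) -> Cmod z = 1 ->
  koebe_radius (INR T) <= Cmod (trinomial T a b z).
Proof.
  intros HT Hinj Hz. destruct (INR_cases T HT) as [HT1 HTc].
  destruct (INR_freqs T) as [Hf1 Hf2].
  destruct (unit_circle_cis z Hz) as (t & _ & ->). rewrite Cmod_trinomial_cis.
  assert (Hk := koebe_radius_pos (INR T) HT1).
  rewrite <- (sqrt_pow2 (koebe_radius (INR T))) by lra.
  apply sqrt_le_1_alt.
  assert (Hsym : exists x, -1 <= x <= 1 /\
    circle_form a b (cos (INR T * t)) = circle_form (Rabs a) b x).
  { pose proof (COS_bound (INR T * t)). destruct (Rle_lt_dec 0 a).
    - exists (cos (INR T * t)). rewrite Rabs_pos_eq; auto.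
    - exists (- cos (INR T * t)). rewrite Rabs_left by auto.
      split; [lra|]. unfold circle_form. ring. }
  destruct Hsym as (x & Hx & ->).
  apply circle_form_koebe; auto.
  - apply Rabs_pos.
  - rewrite <- Hf2. apply (last_coefficient_bound T a b HT Hinj).
  - intros s Hs. rewrite <- Hf1, <- Hf2.
    eapply Rle_trans; [|apply (dieudonne_condition T a b s HT Hinj Hs)].
    rewrite Rabs_mult. apply Rmult_le_compat_l; [apply Rabs_pos|apply Rle_abs].
Qed.

(** * The extremal value *)

Lemma extremal_coefficients (T : nat) :
  a0 T = extremal_a (INR T) /\ b0 T = extremal_b (INR T).
Proof.
  pose proof (pos_INR T).
  assert (Hc : contact_cos (INR T) = cos (PI * INR T / (2 + 3 * INR T))).
  { unfold contact_cos, contact_angle, total_freq. f_equal. field. lra. }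
  unfold a0, b0, extremal_a, extremal_b, total_freq. rewrite Hc. split; field; lra.
Qed.

Lemma koebe_radius_eq (T : R) :
  1 <= T -> koebe_radius T = 4 * cos (PI * (1 + T) / (2 + 3 * T)) ^ 2.
Proof.
  intros HT. unfold koebe_radius, contact_cos, contact_angle, total_freq.
  set (x := PI * (1 + T) / (2 + 3 * T)).
  replace (T * (PI / (2 + 3 * T))) with (- (2 * x - PI)) by (unfold x; field; lra).
  rewrite cos_neg, cos_minus, cos_PI, sin_PI, cos_2a_cos. ring.
Qed.

Lemma Cexp_PI_over (T : R) : T <> 0 -> Cexp (Ci * PI / T)%C = cis (PI / T).
Proof.
  intros HT. rewrite <- Cexp_imaginary. f_equal.
  rewrite RtoC_div by auto. unfold Cdiv. ring.
Qed.

Lemma extremal_value (T : nat) :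
  (1 <= T)%nat -> Cmod (B T (Cexp (Ci * PI / INR T)%C)) = koebe_radius (INR T).
Proof.
  intros HT. destruct (INR_cases T HT) as [HT1 _].
  destruct (extremal_coefficients T) as [Ea Eb].
  rewrite Cexp_PI_over by lra. unfold B. rewrite Cmod_trinomial_cis, Ea, Eb.
  replace (INR T * (PI / INR T)) with PI by (field; lra).
  rewrite cos_PI.
  assert (Hk := koebe_radius_pos (INR T) HT1).
  rewrite <- (sqrt_pow2 (koebe_radius (INR T))) by lra. f_equal.
  unfold circle_form, koebe_radius, extremal_a. ring.
Qed.

Theorem theorem4p1 (T : nat) (hT : (1 <= T)%nat) :
  (forall F : C -> C, class_S T F -> exists m : R, is_circle_min F m) /\
  is_minimum (fun m => exists F : C -> C, class_S T F /\ is_circle_min F m)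
    (Cmod (B T (Cexp (Ci * PI / INR T)%C))) /\
  Cmod (B T (Cexp (Ci * PI / INR T)%C)) =
    4 * cos (PI * (1 + INR T) / (2 + 3 * INR T)) ^ 2.
Proof.
  destruct (INR_cases T hT) as [HT1 _].
  rewrite (extremal_value T hT).
  split; [|split; [split|]].
  - intros F [(a & b & HF) _]. apply (circle_min_exists T a b F HF).
  - destruct (extremal_coefficients T) as [Ea Eb].
    assert (Hinj : injective_on unit_disk (B T)).
    { unfold B. rewrite Ea, Eb. apply extremal_injective; auto. }
    exists (B T). split; [split; [|split]|split].
    + exists (a0 T), (b0 T). reflexivity.
    + apply trinomial_holomorphic.
    + exact Hinj.
    + exists (Cexp (Ci * PI / INR T)%C). split; [|symmetry; apply extremal_value; auto].
      rewrite Cexp_PI_over by lra. apply Cmod_cis.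
    + intros x (z & Hz & ->). apply univalent_trinomial_koebe; auto.
  - intros m (F & [(a & b & HF) [_ Hinj]] & (z & Hz & ->) & _).
    rewrite HF. apply univalent_trinomial_koebe; auto.
    intros x y Hx Hy E. apply Hinj; auto. rewrite !HF. exact E.
  - apply koebe_radius_eq; auto.
Qed.
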